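(* For any $k\in\omega$, $$\Delta^0_k\mathsf{LCP}(\Pi^0_1)\equiv_W\Delta^0_k\mathsf{LCP}(\Sigma^0_2)\equiv_W\Delta^0_k\mathsf{LPP}.$$ Moreover, if $k=2$, then $$\Delta^0_k\mathsf{LPP}\equiv_W\Delta^0_k\mathsf{LFP}(\Pi^0_1),$$ and if $k\geq 3$, then $$\Delta^0_k\mathsf{LPP}\equiv_W\Delta^0_k\mathsf{LFP}(\Pi^0_1)\equiv_W\Delta^0_k\mathsf{LFP}(\Sigma^0_2).$$
   Context: A (Weihrauch) problem is a partial function $\mathsf{P}$ from $\mathcal{P}(\omega)$ to $\mathcal{P}(\mathcal{P}(\omega))$ with nonempty domain; for $X\in\mathrm{dom}(\mathsf{P})$ (an input) the elements of $\mathsf{P}(X)$ are its outputs. Numbers, functions, tuples and sequences of sets are identified with subsets of $\omega$ via canonical computable bijections. $\mathsf{P}\leq_W\mathsf{Q}$ means there are computable functionals $\Phi,\Psi$ such that for all $X\in\mathrm{dom}(\mathsf{P})$, $\Phi(X)$ is defined and in $\mathrm{dom}(\mathsf{Q})$, and for all $Y\in\mathsf{Q}(\Phi(X))$, $\Psi(X,Y)$ is defined and in $\mathsf{P}(X)$. $\equiv_W$ means reducibility in both directions. $Y\in\Delta^0_k(X)$ means $Y$ is $\Delta^0_k$-definable from $X$ (for $k=m+1$, equivalently $Y$ is computable from the $m$-th Turing jump $X^{(m)}$). For $f,g\in\omega^\omega$, $f<_l g$ means $\exists n\,(f[n]=g[n]\wedge f(n)<g(n))$, where $f[n]$ is the initial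 segment of length $n$. $\Delta^0_k\mathsf{LPP}$: an input is an ill-founded tree $T\subseteq\omega^{<\omega}$ and a path $f$ of $T$; an output is a path $g$ of $T$ such that there is no $\Delta^0_k(T\oplus f\oplus g)$ path $h$ of $T$ with $h<_l g$. A formula $\varphi(n,X,Y)$ of second-order arithmetic in negation normal form is $X$-positive if it has no subformula of the form $t\notin X$. For $\Omega'\in\{\Pi^0_1,\Sigma^0_2\}$, an input for either $\Delta^0_k\mathsf{LFP}(\Omega')$ or $\Delta^0_k\mathsf{LCP}(\Omega')$ is a set $A\subseteq\omega$ and a G\''odel number of an $X$-positive formula $\varphi(n,X,Y)\in\Omega'$; put $\Gamma(X)=\{n:\varphi(n,X,A)\}$. An output of $\Delta^0_k\mathsf{LFP}(\Omega')$ is a fixed point $X$ of $\Gamma$ such that there is no $\Delta^0_k(A\oplus X)$-definable fixed point $Y$ of $\Gamma$ with $Y\subsetneq X$. An output of $\Delta^0_k\mathsf{LCP}(\Omega')$ is a closed point $X$ of $\Gamma$ (i.e. $\Gamma(X)\subseteq X$) such that there is no $\Delta^0_k(A\oplus X)$-definable closed point $Y$ of $\Gamma$ with $Y\subsetneq X$. *)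

(* Defs.v *)
From Stdlib Require Import Arith List.
From Stdlib Require Cantor.
Import ListNotations.

(** * Subsets of omega *)

Definition natset : Type := nat -> Prop.

(* Equality of sets is extensional. *)
Definition set_eq (X Y : natset) : Prop := forall n, X n <-> Y n.
Definition set_sub (X Y : natset) : Prop := forall n, X n -> Y n.
Definition set_psub (X Y : natset) : Prop := set_sub X Y /\ ~ set_eq X Y.

Notation "X ≡ Y" := (set_eq X Y) (at level 70, no associativity).
Notation "X ⊆ Y" := (set_sub X Y) (at level 70, no associativity).
Notation "X ⊊ Y" := (set_psub X Y) (at level 70, no associativity).

(* X (+) Y = {2n : n in X} u {2n+1 : n in Y} *)
Definition join (X Y : natset) : natset :=
  fun n => if Nat.even n then X (Nat.div2 n) else Y (Nat.div2 n).

Notation "X ⊕ Y" := (join X Y) (at level 50, left associativity).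

Definition singleton (e : nat) : natset := fun n => n = e.

(** ** Identification of pairs, sequences, functions and trees with numbers
    and subsets of omega *)

Definition npair (a b : nat) : nat := Cantor.to_nat (a, b).
Definition nfst (c : nat) : nat := fst (Cantor.of_nat c).
Definition nsnd (c : nat) : nat := snd (Cantor.of_nat c).

Fixpoint seqcode (s : list nat) : nat :=
  match s with
  | [] => 0
  | a :: s' => S (npair a (seqcode s'))
  end.

Definition graph (f : nat -> nat) : natset :=
  fun c => exists n, c = npair n (f n).

Definition treeset (T : list nat -> Prop) : natset :=
  fun c => exists s, c = seqcode s /\ T s.

(** * Computable functionals *)

(* Programs for the unary partial functions that are recursive in an oracle;
   several arguments are passed as one through [npair]. *)
Inductive program : Type :=
| PZero
| PSucc
| PFst
| PSnd
| POracle
| PPair (p q : program)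
| PComp (p q : program)
| PRec (p q : program)
| PMu (p : program).

Fixpoint rec_rel (F G : nat -> nat -> Prop) (a n r : nat) : Prop :=
  match n with
  | 0 => F a r
  | S m => exists r', rec_rel F G a m r' /\ G (npair a (npair m r')) r
  end.

(* [eval X p a r]: with oracle X, the program p halts on a with value r. *)
Fixpoint eval (X : natset) (p : program) (a r : nat) : Prop :=
  match p with
  | PZero => r = 0
  | PSucc => r = S a
  | PFst => r = nfst a
  | PSnd => r = nsnd a
  | POracle => (X a /\ r = 1) \/ (~ X a /\ r = 0)
  | PPair p q =>
      exists u v, eval X p a u /\ eval X q a v /\ r = npair u v
  | PComp p q => exists u, eval X q a u /\ eval X p u r
  | PRec p q => rec_rel (eval X p) (eval X q) (nfst a) (nsnd a) r
  | PMu p =>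
      eval X p (npair a r) 0 /\
      forall i, i < r -> exists v, eval X p (npair a i) (S v)
  end.

(* The computable functional with program p is defined at X with value Y, that
   is, p with oracle X computes the characteristic function of Y. *)
Definition functional (p : program) (X Y : natset) : Prop :=
  forall n, (Y n -> eval X p n 1) /\ (~ Y n -> eval X p n 0).

(** * Problems and Weihrauch reducibility *)

(* [out X] is the set of outputs on the input X; it matters for X in the domain
   only, where it is allowed to be empty. *)
Record problem : Type := Problem {
  dom : natset -> Prop;
  out : natset -> natset -> Prop;
  dom_nonempty : exists X, dom X
}.

Definition weihrauch_le (P Q : problem) : Prop :=
  exists phi psi : program,
  forall X, dom P X ->
  exists X', functional phi X X' /\ dom Q X' /\
  forall Y, out Q X' Y ->
  exists Z, functional psi (X ⊕ Y) Z /\ out P X Z.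

Definition weihrauch_equiv (P Q : problem) : Prop :=
  weihrauch_le P Q /\ weihrauch_le Q P.

Notation "P ≤W Q" := (weihrauch_le P Q) (at level 70, no associativity).
Notation "P ≡W Q" := (weihrauch_equiv P Q) (at level 70, no associativity).

(** * Formulas *)

(* Number variables are de Bruijn indices, set variables are numbers. *)
Inductive term : Type :=
| Var (i : nat)
| Zero
| One
| Add (t s : term)
| Mul (t s : term).

(* Formulas of second-order arithmetic in negation normal form. Since only
   arithmetical formulas are used, there are no set quantifiers. The bounded
   quantifiers [BAll t], [BEx t] bind a number variable in their body but not
   in the bound t. *)
Inductive formula : Type :=
| Eq (t s : term)
| Neq (t s : term)
| Lt (t s : term)
| Nlt (t s : term)
| Mem (t : term) (v : nat)
| Nmem (t : term) (v : nat)
| And (f g : formula)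
| Or (f g : formula)
| BAll (t : term) (f : formula)
| BEx (t : term) (f : formula)
| All (f : formula)
| Ex (f : formula).

Fixpoint tval (e : nat -> nat) (t : term) : nat :=
  match t with
  | Var i => e i
  | Zero => 0
  | One => 1
  | Add t s => tval e t + tval e s
  | Mul t s => tval e t * tval e s
  end.

Definition scons (a : nat) (e : nat -> nat) : nat -> nat :=
  fun i => match i with 0 => a | S j => e j end.

Fixpoint sat (V : nat -> natset) (e : nat -> nat) (f : formula) : Prop :=
  match f with
  | Eq t s => tval e t = tval e s
  | Neq t s => tval e t <> tval e s
  | Lt t s => tval e t < tval e s
  | Nlt t s => ~ tval e t < tval e s
  | Mem t v => V v (tval e t)
  | Nmem t v => ~ V v (tval e t)
  | And f g => sat V e f /\ sat V e g
  | Or f g => sat V e f \/ sat V e g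
  | BAll t f => forall a, a < tval e t -> sat V (scons a e) f
  | BEx t f => exists a, a < tval e t /\ sat V (scons a e) f
  | All f => forall a, sat V (scons a e) f
  | Ex f => exists a, sat V (scons a e) f
  end.

Fixpoint tscoped (m : nat) (t : term) : Prop :=
  match t with
  | Var i => i < m
  | Zero | One => True
  | Add t s | Mul t s => tscoped m t /\ tscoped m s
  end.

(* The free number variables are below m and the set variables below l. *)
Fixpoint scoped (m l : nat) (f : formula) : Prop :=
  match f with
  | Eq t s | Neq t s | Lt t s | Nlt t s => tscoped m t /\ tscoped m s
  | Mem t v | Nmem t v => tscoped m t /\ v < l
  | And f g | Or f g => scoped m l f /\ scoped m l g
  | BAll t f | BEx t f => tscoped m t /\ scoped (S m) l f
  | All f | Ex f => scoped (S m) l f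
  end.

Fixpoint bounded (f : formula) : Prop :=
  match f with
  | Eq _ _ | Neq _ _ | Lt _ _ | Nlt _ _ | Mem _ _ | Nmem _ _ => True
  | And f g | Or f g => bounded f /\ bounded g
  | BAll _ f | BEx _ f => bounded f
  | All _ | Ex _ => False
  end.

(* Sigma^0_k and Pi^0_k formulas: k alternating unbounded quantifiers followed
   by a bounded formula. *)
Inductive Sigma0 : nat -> formula -> Prop :=
| Sigma0_bounded f : bounded f -> Sigma0 0 f
| Sigma0_Ex k f : Pi0 k f -> Sigma0 (S k) (Ex f)
with Pi0 : nat -> formula -> Prop :=
| Pi0_bounded f : bounded f -> Pi0 0 f
| Pi0_All k f : Sigma0 k f -> Pi0 (S k) (All f).

(* No subformula says that some t is not in the set variable v. *)
Fixpoint positive (v : nat) (f : formula) : Prop :=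
  match f with
  | Eq _ _ | Neq _ _ | Lt _ _ | Nlt _ _ | Mem _ _ => True
  | Nmem _ w => w <> v
  | And f g | Or f g => positive v f /\ positive v g
  | BAll _ f | BEx _ f | All f | Ex f => positive v f
  end.

Fixpoint tgodel (t : term) : nat :=
  match t with
  | Var i => npair 0 i
  | Zero => npair 1 0
  | One => npair 2 0
  | Add t s => npair 3 (npair (tgodel t) (tgodel s))
  | Mul t s => npair 4 (npair (tgodel t) (tgodel s))
  end.

Fixpoint godel (f : formula) : nat :=
  match f with
  | Eq t s => npair 0 (npair (tgodel t) (tgodel s))
  | Neq t s => npair 1 (npair (tgodel t) (tgodel s))
  | Lt t s => npair 2 (npair (tgodel t) (tgodel s))
  | Nlt t s => npair 3 (npair (tgodel t) (tgodel s))
  | Mem t v => npair 4 (npair (tgodel t) v)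
  | Nmem t v => npair 5 (npair (tgodel t) v)
  | And f g => npair 6 (npair (godel f) (godel g))
  | Or f g => npair 7 (npair (godel f) (godel g))
  | BAll t f => npair 8 (npair (tgodel t) (godel f))
  | BEx t f => npair 9 (npair (tgodel t) (godel f))
  | All f => npair 10 (godel f)
  | Ex f => npair 11 (godel f)
  end.

(* Y = {n : phi(n, X)}. Parameters from omega are not needed, every natural
   number being the value of a closed term. *)
Definition defines (phi : formula) (X Y : natset) : Prop :=
  scoped 1 1 phi /\
  forall n, Y n <-> sat (fun _ => X) (scons n (fun _ => 0)) phi.

(* Y is Delta^0_k-definable from X. For k = 0 this is definability by a bounded
   formula with set parameter X. *)
Definition Delta0 (k : nat) (X Y : natset) : Prop :=
  (exists phi, Sigma0 k phi /\ defines phi X Y) /\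
  (exists psi, Pi0 k psi /\ defines psi X Y).

(** * The relative leftmost path principle *)

Definition is_tree (T : list nat -> Prop) : Prop :=
  forall s t, T (s ++ t) -> T s.

Definition initseg (f : nat -> nat) (n : nat) : list nat := map f (seq 0 n).

Definition is_path (T : list nat -> Prop) (f : nat -> nat) : Prop :=
  forall n, T (initseg f n).

Definition ill_founded (T : list nat -> Prop) : Prop := exists f, is_path T f.

Definition lex_lt (f g : nat -> nat) : Prop :=
  exists n, initseg f n = initseg g n /\ f n < g n.

Definition LPP_input (Z : natset) (T : list nat -> Prop) (f : nat -> nat) : Prop :=
  is_tree T /\ ill_founded T /\ is_path T f /\ Z ≡ treeset T ⊕ graph f.

Definition LPP_output (k : nat) (T : list nat -> Prop) (f g : nat -> nat) : Prop :=
  is_path T g /\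
  ~ exists h, is_path T h /\
              Delta0 k (treeset T ⊕ graph f ⊕ graph g) (graph h) /\
              lex_lt h g.

Lemma LPP_dom_nonempty : exists Z T f, LPP_input Z T f.
Proof.
  exists (treeset (fun _ => True) ⊕ graph (fun _ => 0)), (fun _ => True), (fun _ => 0).
  repeat split; auto. now exists (fun _ => 0).
Qed.

Definition LPP (k : nat) : problem :=
  {| dom := fun Z => exists T f, LPP_input Z T f;
     out := fun Z W => exists T f g,
              LPP_input Z T f /\ LPP_output k T f g /\ W ≡ graph g;
     dom_nonempty := LPP_dom_nonempty |}.

(** * Relative least fixed points and closed points *)

Inductive opclass : Type := Pi01 | Sigma02.

Definition in_class (c : opclass) (phi : formula) : Prop :=
  match c with Pi01 => Pi0 1 phi | Sigma02 => Sigma0 2 phi end.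

(* phi(n, X, Y): n is the number variable 0, X and Y are the set variables 0
   and 1. *)
Definition Gamma (phi : formula) (A X : natset) : natset :=
  fun n => sat (fun v => match v with 0 => X | _ => A end)
               (scons n (fun _ => 0)) phi.

Definition fixed_point (phi : formula) (A X : natset) : Prop := Gamma phi A X ≡ X.
Definition closed_point (phi : formula) (A X : natset) : Prop := Gamma phi A X ⊆ X.

Definition op_input (c : opclass) (Z A : natset) (phi : formula) : Prop :=
  in_class c phi /\ scoped 1 2 phi /\ positive 0 phi /\
  Z ≡ A ⊕ singleton (godel phi).

Definition LFP_output (k : nat) (A : natset) (phi : formula) (X : natset) : Prop :=
  fixed_point phi A X /\
  ~ exists Y, Delta0 k (A ⊕ X) Y /\ fixed_point phi A Y /\ Y ⊊ X.

Definition LCP_output (k : nat) (A : natset) (phi : formula) (X : natset) : Prop :=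
  closed_point phi A X /\
  ~ exists Y, Delta0 k (A ⊕ X) Y /\ closed_point phi A Y /\ Y ⊊ X.

Lemma op_dom_nonempty (c : opclass) : exists Z A phi, op_input c Z A phi.
Proof.
  set (th := Eq Zero Zero).
  destruct c.
  - exists (singleton 0 ⊕ singleton (godel (All th))), (singleton 0), (All th).
    repeat split; auto; simpl; auto. repeat constructor.
  - exists (singleton 0 ⊕ singleton (godel (Ex (All th)))), (singleton 0), (Ex (All th)).
    repeat split; auto; simpl; auto. repeat constructor.
Qed.

Definition LFP (k : nat) (c : opclass) : problem :=
  {| dom := fun Z => exists A phi, op_input c Z A phi;
     out := fun Z X => exists A phi, op_input c Z A phi /\ LFP_output k A phi X;
     dom_nonempty := op_dom_nonempty c |}.

Definition LCP (k : nat) (c : opclass) : problem :=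
  {| dom := fun Z => exists A phi, op_input c Z A phi;
     out := fun Z X => exists A phi, op_input c Z A phi /\ LCP_output k A phi X;
     dom_nonempty := op_dom_nonempty c |}.

(* Main.v *)
From Stdlib Require Import Arith List Lia Classical ClassicalEpsilon
  FunctionalExtensionality PropExtensionality.
From Stdlib Require Cantor.
Require Import Defs.
Import ListNotations.

(** Why the equivalences hold.

    All the problems sit on one cycle of reductions, and every arrow of it
    comes from a correspondence between paths and closed points.

    From closed points to paths ([LCP_le_LPP]).  Let the operator be given by
    the formula ∃x∀y θ(y,x,n,X,A), with the quantifier on x absent in the
    Π⁰₁ case.  That X is closed means that for every pair (n,x) either n is in
    X or some y refutes θ(y,x,n,X,A).  The tree [ctree] has as paths the
    sequences that list the bits of X (and of A), interleaved with such
    witnesses.  Smaller sets have lexicographically smaller bits.  As θ is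
    X-positive, a y that refutes θ for X still refutes it for a subset Y of X;
    so a closed point Y ⊊ X yields a path that keeps the earlier witnesses and
    is to the left of the path of X ([new_path_lex]).  The pair (n,x) is
    treated at a position beyond the bit of n, so that the decision for n is
    already taken there.  The tree has to be computed from A and the Gödel
    number of the formula, which needs a program that decides the truth of
    bounded formulas ([Dec_truth]).

    From paths to fixed points ([LPP_le_LFP], [LPP_le_LCP]).  Let Γ(X) consist
    of the nodes all of whose children in T are in X.  The complement of a
    fixed point X is a subtree of T without dead ends.  For a path h of T the
    nodes on h can be added to this subtree, so if X is relatively minimal,
    then every path h that is definable from X runs inside the complement of X
    ([captures]).  Hence the input path shows that the subtree is not empty;
    its leftmost path g is Δ⁰₁ in X, and no definable h is to the left of g.

    At level 0 this is not enough, because g is only Δ⁰₁ in X and Δ⁰₀ is not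
    closed under Δ⁰₁ reductions.  For this reason the nodes carry a second
    component, a padding: the set of the nodes (h[n],w) in which w bounds the
    computations of the values of h is Δ⁰₀ even when h is only Δ⁰₁, and it
    still meets every level of h ([LCP0_captures]).  Removing it from X leaves
    a closed point, though not always a fixed one.

    Finally, a relatively minimal closed point is always a fixed point, since
    a number n in X that is outside Γ(X) could be removed from X
    ([minimal_closed_fixed]).  So the identity reduces least fixed points to
    least closed points, and the cycle is complete. *)

(** * Pairs and joins *)

Lemma set_eq_eq X Y : X ≡ Y -> X = Y.
Proof.
  intro H. apply functional_extensionality. intro n.
  apply propositional_extensionality, H.
Qed.

Lemma join_even X Y n : (X ⊕ Y) (2 * n) <-> X n.
Proof.
  unfold join. now rewrite Nat.even_even, Nat.div2_double.
Qed.

Lemma join_odd X Y n : (X ⊕ Y) (2 * n + 1) <-> Y n.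
Proof.
  unfold join. now rewrite Nat.even_odd, Nat.add_1_r, Nat.div2_succ_double.
Qed.

Lemma even_or_odd n : exists d, n = 2 * d \/ n = 2 * d + 1.
Proof.
  destruct (Nat.Even_or_Odd n) as [[d H]|[d H]]; exists d; lia.
Qed.

Lemma join_spec X Y n :
  (X ⊕ Y) n <-> (exists d, n = 2 * d /\ X d) \/ (exists d, n = 2 * d + 1 /\ Y d).
Proof.
  destruct (even_or_odd n) as [d [->| ->]].
  - rewrite join_even. split; [intro; left; eauto|].
    intros [(c & E & H)|(c & E & H)]; [|lia]. now replace d with c by lia.
  - rewrite join_odd. split; [intro; right; eauto|].
    intros [(c & E & H)|(c & E & H)]; [lia|]. now replace d with c by lia.
Qed.

Lemma join_inj X Y X' Y' : X ⊕ Y = X' ⊕ Y' -> X = X' /\ Y = Y'.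
Proof.
  intro H. split; apply set_eq_eq; intro n.
  - now rewrite <- (join_even X Y n), H, join_even.
  - now rewrite <- (join_odd X Y n), H, join_odd.
Qed.

Lemma nfst_npair a b : nfst (npair a b) = a.
Proof. unfold nfst, npair. now rewrite Cantor.cancel_of_to. Qed.

Lemma nsnd_npair a b : nsnd (npair a b) = b.
Proof. unfold nsnd, npair. now rewrite Cantor.cancel_of_to. Qed.

Lemma npair_eta c : npair (nfst c) (nsnd c) = c.
Proof.
  unfold nfst, nsnd, npair. rewrite <- surjective_pairing. apply Cantor.cancel_to_of.
Qed.

Lemma npair_inj a b c d : npair a b = npair c d -> a = c /\ b = d.
Proof.
  intro H. split.
  - now rewrite <- (nfst_npair a b), H, nfst_npair.
  - now rewrite <- (nsnd_npair a b), H, nsnd_npair.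
Qed.

Lemma npair_spec a b : 2 * npair a b = (a + b) * (a + b + 1) + 2 * b.
Proof.
  unfold npair. rewrite Nat.mul_comm, Cantor.to_nat_spec. lia.
Qed.

Lemma npair_ge a b : a <= npair a b /\ b <= npair a b.
Proof. pose proof (npair_spec a b). nia. Qed.

Lemma npair_mono a b c d : a <= c -> b <= d -> npair a b <= npair c d.
Proof.
  intros. pose proof (npair_spec a b). pose proof (npair_spec c d).
  assert ((a + b) * (a + b + 1) <= (c + d) * (c + d + 1)) by (apply Nat.mul_le_mono; lia).
  lia.
Qed.

Lemma nfst_le c : nfst c <= c.
Proof. rewrite <- (npair_eta c) at 2. apply npair_ge. Qed.

Lemma nsnd_le c : nsnd c <= c.
Proof. rewrite <- (npair_eta c) at 2. apply npair_ge. Qed.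

(** * Substitution and negation in formulas *)

Fixpoint tsub (s : nat -> term) (t : term) : term :=
  match t with
  | Var i => s i
  | Zero => Zero
  | One => One
  | Add t u => Add (tsub s t) (tsub s u)
  | Mul t u => Mul (tsub s t) (tsub s u)
  end.

Definition tlift (t : term) : term := tsub (fun i => Var (S i)) t.

Definition up (s : nat -> term) : nat -> term :=
  fun i => match i with 0 => Var 0 | S j => tlift (s j) end.

Fixpoint fsub (s : nat -> term) (f : formula) : formula :=
  match f with
  | Eq t u => Eq (tsub s t) (tsub s u)
  | Neq t u => Neq (tsub s t) (tsub s u)
  | Lt t u => Lt (tsub s t) (tsub s u)
  | Nlt t u => Nlt (tsub s t) (tsub s u)
  | Mem t v => Mem (tsub s t) v
  | Nmem t v => Nmem (tsub s t) v
  | And f g => And (fsub s f) (fsub s g)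
  | Or f g => Or (fsub s f) (fsub s g)
  | BAll t f => BAll (tsub s t) (fsub (up s) f)
  | BEx t f => BEx (tsub s t) (fsub (up s) f)
  | All f => All (fsub (up s) f)
  | Ex f => Ex (fsub (up s) f)
  end.

Fixpoint neg (f : formula) : formula :=
  match f with
  | Eq t u => Neq t u
  | Neq t u => Eq t u
  | Lt t u => Nlt t u
  | Nlt t u => Lt t u
  | Mem t v => Nmem t v
  | Nmem t v => Mem t v
  | And f g => Or (neg f) (neg g)
  | Or f g => And (neg f) (neg g)
  | BAll t f => BEx t (neg f)
  | BEx t f => BAll t (neg f)
  | All f => Ex (neg f)
  | Ex f => All (neg f)
  end.

Lemma tval_tsub e s t : tval e (tsub s t) = tval (fun i => tval e (s i)) t.
Proof. induction t; simpl; auto. Qed.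

Lemma tval_tlift a e t : tval (scons a e) (tlift t) = tval e t.
Proof. unfold tlift. now rewrite tval_tsub. Qed.

Lemma tval_up a e s :
  (fun i => tval (scons a e) (up s i)) = scons a (fun i => tval e (s i)).
Proof.
  apply functional_extensionality. intros [|i]; simpl; auto. apply tval_tlift.
Qed.

Lemma sat_fsub V f : forall e r,
  sat V e (fsub r f) <-> sat V (fun i => tval e (r i)) f.
Proof.
  induction f; intros e r; simpl; rewrite ?tval_tsub; try tauto.
  - rewrite IHf1, IHf2. tauto.
  - rewrite IHf1, IHf2. tauto.
  - setoid_rewrite IHf. setoid_rewrite tval_up. tauto.
  - setoid_rewrite IHf. setoid_rewrite tval_up. tauto.
  - setoid_rewrite IHf. setoid_rewrite tval_up. tauto.
  - setoid_rewrite IHf. setoid_rewrite tval_up. tauto.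
Qed.

Lemma tscoped_tsub m m' s t :
  tscoped m t -> (forall i, i < m -> tscoped m' (s i)) -> tscoped m' (tsub s t).
Proof. induction t; simpl; intuition. Qed.

Lemma tscoped_tlift m t : tscoped m t -> tscoped (S m) (tlift t).
Proof. intro H. apply tscoped_tsub with m; simpl; auto with arith. Qed.

Lemma tscoped_up m m' s :
  (forall i, i < m -> tscoped m' (s i)) ->
  forall i, i < S m -> tscoped (S m') (up s i).
Proof.
  intros H [|i] Hi; simpl; [lia|]. apply tscoped_tlift, H. lia.
Qed.

Lemma scoped_fsub l f : forall m m' r,
  scoped m l f -> (forall i, i < m -> tscoped m' (r i)) -> scoped m' l (fsub r f).
Proof.
  induction f; simpl; intros m m' r H Hr;
    intuition eauto using tscoped_tsub, tscoped_up.
Qed.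

Lemma bounded_fsub f : forall r, bounded f -> bounded (fsub r f).
Proof. induction f; simpl; intuition. Qed.

Lemma hierarchy_fsub k : forall f s,
  (Sigma0 k f -> Sigma0 k (fsub s f)) /\ (Pi0 k f -> Pi0 k (fsub s f)).
Proof.
  induction k; intros f s; split; intro H; inversion H; subst; simpl;
    constructor; try apply IHk; auto using bounded_fsub.
Qed.

Lemma sat_neg V f : forall e, sat V e (neg f) <-> ~ sat V e f.
Proof.
  induction f; intro e; simpl; try solve [tauto | split; [tauto|apply NNPP]].
  - rewrite IHf1, IHf2. tauto.
  - rewrite IHf1, IHf2. tauto.
  - setoid_rewrite IHf. split; [firstorder|].
    intro H. apply NNPP. intro H'. apply H. intros a Ha. apply NNPP. firstorder.
  - setoid_rewrite IHf. firstorder.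
  - setoid_rewrite IHf. split; [firstorder|].
    intro H. apply NNPP. intro H'. apply H. intros a. apply NNPP. firstorder.
  - setoid_rewrite IHf. firstorder.
Qed.

Lemma scoped_neg l f : forall m, scoped m l f -> scoped m l (neg f).
Proof. induction f; simpl; intuition. Qed.

Lemma bounded_neg f : bounded f -> bounded (neg f).
Proof. induction f; simpl; intuition. Qed.

Lemma hierarchy_neg k : forall f,
  (Sigma0 k f -> Pi0 k (neg f)) /\ (Pi0 k f -> Sigma0 k (neg f)).
Proof.
  induction k; intros f; split; intro H; inversion H; subst; simpl;
    constructor; try apply IHk; auto using bounded_neg.
Qed.

Lemma tval_ext m e e' t :
  tscoped m t -> (forall i, i < m -> e i = e' i) -> tval e t = tval e' t.
Proof. induction t; simpl; intuition. Qed.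

Lemma scons_ext m a e e' :
  (forall i, i < m -> e i = e' i) -> forall i, i < S m -> scons a e i = scons a e' i.
Proof. intros H [|i] Hi; simpl; auto with arith. Qed.

Lemma sat_ext l f : forall m V e e',
  scoped m l f -> (forall i, i < m -> e i = e' i) -> (sat V e f <-> sat V e' f).
Proof.
  induction f; simpl; intros m V e e' H He.
  1-4: rewrite (tval_ext m e e' t), (tval_ext m e e' s) by intuition; tauto.
  1-2: rewrite (tval_ext m e e' t) by intuition; tauto.
  1-2: rewrite (IHf1 m V e e'), (IHf2 m V e e') by intuition; tauto.
  1-2: rewrite (tval_ext m e e' t) by intuition;
    assert (E : forall a, sat V (scons a e) f <-> sat V (scons a e') f)
    by (intro a; apply (IHf (S m)); [tauto|now apply scons_ext]);
    firstorder.
  1-2: assert (E : forall a, sat V (scons a e) f <-> sat V (scons a e') f)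
    by (intro a; apply (IHf (S m)); [tauto|now apply scons_ext]);
    firstorder.
Qed.

(** * Classes of the arithmetical hierarchy *)

(** The classes consist of relations on environments and not of formulas, so
    that a relation can be shown to be in a class by following the shape of its
    definition. The number m bounds the variables that may occur. *)

Definition SigmaP k (B : natset) m (P : (nat -> nat) -> Prop) : Prop :=
  exists f, Sigma0 k f /\ scoped m 1 f /\ forall e, sat (fun _ => B) e f <-> P e.

Definition PiP k (B : natset) m (P : (nat -> nat) -> Prop) : Prop :=
  exists f, Pi0 k f /\ scoped m 1 f /\ forall e, sat (fun _ => B) e f <-> P e.

Lemma SigmaP_iff {B} k m P Q : (forall e, P e <-> Q e) -> SigmaP k B m P -> SigmaP k B m Q.
Proof.
  intros H (f & ? & ? & Hf). exists f. repeat split; auto; intros; now apply H, Hf || apply Hf, H.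
Qed.

Lemma PiP_iff {B} k m P Q : (forall e, P e <-> Q e) -> PiP k B m P -> PiP k B m Q.
Proof.
  intros H (f & ? & ? & Hf). exists f. repeat split; auto; intros; now apply H, Hf || apply Hf, H.
Qed.

Lemma PiP_not {B} k m P : SigmaP k B m P -> PiP k B m (fun e => ~ P e).
Proof.
  intros (f & ? & ? & Hf). exists (neg f). split; [now apply hierarchy_neg|].
  split; [now apply scoped_neg|]. intro e. now rewrite sat_neg, Hf.
Qed.

Lemma SigmaP_not {B} k m P : PiP k B m P -> SigmaP k B m (fun e => ~ P e).
Proof.
  intros (f & ? & ? & Hf). exists (neg f). split; [now apply hierarchy_neg|].
  split; [now apply scoped_neg|]. intro e. now rewrite sat_neg, Hf.
Qed.

Lemma PiP_from_not {B} k m P : SigmaP k B m (fun e => ~ P e) -> PiP k B m P.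
Proof. intro H. apply PiP_iff with (2 := PiP_not _ _ _ H). intro. split; [apply NNPP|tauto]. Qed.

Lemma SigmaP_from_not {B} k m P : PiP k B m (fun e => ~ P e) -> SigmaP k B m P.
Proof. intro H. apply SigmaP_iff with (2 := SigmaP_not _ _ _ H). intro. split; [apply NNPP|tauto]. Qed.

Lemma SigmaP_sub {B} k m m' P s :
  (forall i, i < m -> tscoped m' (s i)) -> SigmaP k B m P ->
  SigmaP k B m' (fun e => P (fun i => tval e (s i))).
Proof.
  intros Hs (f & ? & ? & Hf). exists (fsub s f). split; [now apply hierarchy_fsub|].
  split; [now apply scoped_fsub with m|]. intro e. now rewrite sat_fsub, Hf.
Qed.

Lemma PiP_sub {B} k m m' P s :
  (forall i, i < m -> tscoped m' (s i)) -> PiP k B m P ->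
  PiP k B m' (fun e => P (fun i => tval e (s i))).
Proof.
  intros Hs (f & ? & ? & Hf). exists (fsub s f). split; [now apply hierarchy_fsub|].
  split; [now apply scoped_fsub with m|]. intro e. now rewrite sat_fsub, Hf.
Qed.

Lemma SigmaP_ex {B} k m Q :
  PiP k B (S m) Q -> SigmaP (S k) B m (fun e => exists a, Q (scons a e)).
Proof.
  intros (f & ? & ? & Hf). exists (Ex f). split; [now constructor|]. split; [easy|].
  intro e. simpl. now setoid_rewrite Hf.
Qed.

Lemma SigmaP_ex_inv {B} k m P :
  SigmaP (S k) B m P ->
  exists Q, PiP k B (S m) Q /\ forall e, P e <-> exists a, Q (scons a e).
Proof.
  intros (f & Hk & Hm & Hf). inversion Hk; subst.
  exists (fun e => sat (fun _ => B) e f0). split.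
  - exists f0. now repeat split.
  - intro e. now rewrite <- Hf.
Qed.

Lemma PiP_all {B} k m Q :
  SigmaP k B (S m) Q -> PiP (S k) B m (fun e => forall a, Q (scons a e)).
Proof.
  intro H. apply PiP_from_not.
  refine (SigmaP_iff _ _ _ _ _ (SigmaP_ex k m (fun e => ~ Q e) (PiP_not _ _ _ H))).
  intro e. split.
  - intros [a Ha] N. auto.
  - intro N. apply NNPP. intro N'. apply N. intro a. apply NNPP. eauto.
Qed.

Record closed_class (C : nat -> ((nat -> nat) -> Prop) -> Prop) : Prop := {
  cl_and : forall m P Q, C m P -> C m Q -> C m (fun e => P e /\ Q e);
  cl_or : forall m P Q, C m P -> C m Q -> C m (fun e => P e \/ Q e);
  cl_bex : forall m t P, tscoped m t -> C (S m) P ->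
    C m (fun e => exists a, a < tval e t /\ P (scons a e));
  cl_ball : forall m t P, tscoped m t -> C (S m) P ->
    C m (fun e => forall a, a < tval e t -> P (scons a e))
}.

Lemma PiP_closed_of_SigmaP {B} k : closed_class (SigmaP k B) -> closed_class (PiP k B).
Proof.
  intro H. split; intros; apply PiP_from_not.
  - apply SigmaP_iff with (P := fun e => ~ P e \/ ~ Q e).
    + intro; tauto.
    + apply H; now apply SigmaP_not.
  - apply SigmaP_iff with (P := fun e => ~ P e /\ ~ Q e).
    + intro; tauto.
    + apply H; now apply SigmaP_not.
  - apply SigmaP_iff with (P := fun e => forall a, a < tval e t -> ~ P (scons a e)).
    + firstorder.
    + apply (cl_ball _ H m t (fun e => ~ P e)); auto. now apply SigmaP_not.
  - apply SigmaP_iff with (P := fun e => exists a, a < tval e t /\ ~ P (scons a e)).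
    + intro e. split; [firstorder|]. intro N. apply NNPP. intro N'.
      apply N. intros a Ha. apply NNPP. firstorder.
    + apply (cl_bex _ H m t (fun e => ~ P e)); auto. now apply SigmaP_not.
Qed.

(** Bounding finitely many witnesses at once; this moves bounded quantifiers
    inside unbounded ones. *)
Lemma collection (n : nat) (R : nat -> nat -> Prop) :
  (forall a, a < n -> exists z, R a z) ->
  exists s, forall a, a < n -> exists z, z < s /\ R a z.
Proof.
  induction n; intro H.
  - exists 0. intros; lia.
  - destruct IHn as [s Hs]; [intros; apply H; lia|].
    destruct (H n) as [z Hz]; [lia|].
    exists (s + S z). intros a Ha. destruct (Nat.eq_dec a n) as [->|].
    + exists z. split; [lia|auto].
    + destruct (Hs a) as (z' & ? & ?); [lia|]. exists z'. split; [lia|auto].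
Qed.

(** When the witnesses of an existential quantifier get a common bound s, the
    bound becomes a new variable next to the witness, or next to the witness
    and a bounded variable. These renamings skip the place of s. *)
Definition skip1 : nat -> term :=
  fun i => match i with 0 => Var 0 | S j => Var (S (S j)) end.
Definition skip2 : nat -> term :=
  fun i => match i with 0 => Var 0 | 1 => Var 1 | S (S j) => Var (S (S (S j))) end.

(** The successor step replaces ∃z by ∃s∃z<s. The bounded quantifier or the
    connective then applies to relations of the dual class at the level below,
    where closure is known, and [collection] gives back a common bound s. *)
Lemma SigmaP_closed {B} k : closed_class (SigmaP k B).
Proof.
  induction k.
  - split; intros m.
    + intros P Q (f & Hf & ? & Ef) (g & Hg & ? & Eg). exists (And f g).
      inversion Hf; inversion Hg; subst.
      split; [constructor; simpl; auto|]. split; [simpl; auto|].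
      intro e. simpl. now rewrite Ef, Eg.
    + intros P Q (f & Hf & ? & Ef) (g & Hg & ? & Eg). exists (Or f g).
      inversion Hf; inversion Hg; subst.
      split; [constructor; simpl; auto|]. split; [simpl; auto|].
      intro e. simpl. now rewrite Ef, Eg.
    + intros t P Ht (f & Hf & ? & Ef). exists (BEx t f).
      inversion Hf; subst.
      split; [constructor; simpl; auto|]. split; [simpl; auto|].
      intro e. simpl. now setoid_rewrite Ef.
    + intros t P Ht (f & Hf & ? & Ef). exists (BAll t f).
      inversion Hf; subst.
      split; [constructor; simpl; auto|]. split; [simpl; auto|].
      intro e. simpl. now setoid_rewrite Ef.
  - pose proof (PiP_closed_of_SigmaP k IHk) as PC.
    assert (Hb : forall m Q, PiP k B (S m) Q ->
              PiP k B (S m) (fun e => exists z, z < e 0 /\ Q (scons z (fun i => e (S i))))).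
    { intros m Q HQ.
      pose proof (cl_bex _ PC (S m) (Var 0)
        (fun e => Q (fun i => tval e (skip1 i)))) as H.
      refine (PiP_iff _ _ _ _ _ (H _ _)).
      - intro e.
        assert (E : forall z, (fun i => tval (scons z e) (skip1 i)) = scons z (fun i => e (S i)))
          by (intro z; apply functional_extensionality; now intros [|i]).
        simpl. now setoid_rewrite E.
      - simpl; lia.
      - apply PiP_sub with (S m); auto. intros [|i]; simpl; lia. }
    assert (Hb2 : forall m Q, PiP k B (S (S m)) Q ->
              PiP k B (S (S m)) (fun e => exists z, z < e 1 /\
                Q (scons z (scons (e 0) (fun i => e (S (S i))))))).
    { intros m Q HQ.
      pose proof (cl_bex _ PC (S (S m)) (Var 1)
        (fun e => Q (fun i => tval e (skip2 i)))) as H.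
      refine (PiP_iff _ _ _ _ _ (H _ _)).
      - intro e.
        assert (E : forall z, (fun i => tval (scons z e) (skip2 i)) =
                              scons z (scons (e 0) (fun i => e (S (S i)))))
          by (intro z; apply functional_extensionality; now intros [|[|i]]).
        simpl. now setoid_rewrite E.
      - simpl; lia.
      - apply PiP_sub with (S (S m)); auto. intros [|[|i]]; simpl; lia. }
    split; intros m.
    + intros P P' HP HP'.
      destruct (SigmaP_ex_inv _ _ _ HP) as (Q & HQ & E).
      destruct (SigmaP_ex_inv _ _ _ HP') as (Q' & HQ' & E').
      refine (SigmaP_iff _ _ _ _ _ (SigmaP_ex _ _ _ (cl_and _ PC _ _ _ (Hb _ _ HQ) (Hb _ _ HQ')))).
      intro e. rewrite E, E'. simpl. split.
      * intros (s & (a & ? & ?) & (b & ? & ?)). eauto.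
      * intros [(a & ?) (b & ?)]. exists (S (a + b)).
        split; [exists a|exists b]; split; auto; lia.
    + intros P P' HP HP'.
      destruct (SigmaP_ex_inv _ _ _ HP) as (Q & HQ & E).
      destruct (SigmaP_ex_inv _ _ _ HP') as (Q' & HQ' & E').
      refine (SigmaP_iff _ _ _ _ _ (SigmaP_ex _ _ _ (cl_or _ PC _ _ _ HQ HQ'))).
      intro e. rewrite E, E'. split.
      * intros (a & [H|H]); eauto.
      * intros [[a H]|[a H]]; eauto.
    + intros t P Ht HP.
      destruct (SigmaP_ex_inv _ _ _ HP) as (Q & HQ & E).
      pose proof (cl_bex _ PC (S m) (tlift t)
        (fun e => exists z, z < e 1 /\ Q (scons z (scons (e 0) (fun i => e (S (S i))))))) as H.
      refine (SigmaP_iff _ _ _ _ _ (SigmaP_ex _ _ _ (H _ _))).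
      * intro e. setoid_rewrite E. setoid_rewrite tval_tlift. simpl. split.
        -- intros (s & a & ? & z & ? & ?). eauto.
        -- intros (a & ? & z & ?). exists (S z), a. split; auto. exists z. split; auto.
      * now apply tscoped_tlift.
      * now apply Hb2.
    + intros t P Ht HP.
      destruct (SigmaP_ex_inv _ _ _ HP) as (Q & HQ & E).
      pose proof (cl_ball _ PC (S m) (tlift t)
        (fun e => exists z, z < e 1 /\ Q (scons z (scons (e 0) (fun i => e (S (S i))))))) as H.
      refine (SigmaP_iff _ _ _ _ _ (SigmaP_ex _ _ _ (H _ _))).
      * intro e. setoid_rewrite E. setoid_rewrite tval_tlift. simpl. split.
        -- intros (s & Hs) a Ha. destruct (Hs a Ha) as (z & ? & ?). eauto.
        -- intro G. now apply collection in G.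
      * now apply tscoped_tlift.
      * now apply Hb2.
Qed.

(** * Relations and functions of class Δ *)

Notation tl_env e := (fun i => e (S i)).

(** Being closed under negation and bounded quantifiers at every level k,
    including 0, these classes treat all levels uniformly. *)
Definition DeltaP k B m P : Prop := SigmaP k B m P /\ PiP k B m P.

Lemma DeltaP_iff {B k m P} Q : (forall e, P e <-> Q e) -> DeltaP k B m P -> DeltaP k B m Q.
Proof. intros H [? ?]. split; eauto using SigmaP_iff, PiP_iff. Qed.

Lemma DeltaP_not {B k m P} : DeltaP k B m P -> DeltaP k B m (fun e => ~ P e).
Proof. intros [? ?]. split; auto using SigmaP_not, PiP_not. Qed.

Lemma DeltaP_closed B k : closed_class (DeltaP k B).
Proof.
  pose proof (@SigmaP_closed B k) as HS. pose proof (PiP_closed_of_SigmaP k HS) as HP.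
  split; intros.
  - destruct H, H0. split; now apply cl_and.
  - destruct H, H0. split; now apply cl_or.
  - destruct H0. split; now apply cl_bex.
  - destruct H0. split; now apply cl_ball.
Qed.

Lemma DeltaP_sub {B k} m {m' P} s :
  (forall i, i < m -> tscoped m' (s i)) -> DeltaP k B m P ->
  DeltaP k B m' (fun e => P (fun i => tval e (s i))).
Proof. intros H [? ?]. split; eauto using SigmaP_sub, PiP_sub. Qed.

Lemma PiP_dummy B k m P : SigmaP k B m P -> PiP (S k) B m P.
Proof.
  intros (f & ? & ? & Hf). exists (All (fsub (fun i => Var (S i)) f)).
  split; [constructor; now apply hierarchy_fsub|]. split.
  - simpl. apply scoped_fsub with m; auto. simpl; auto with arith.
  - intro e. simpl. setoid_rewrite sat_fsub. simpl. rewrite <- Hf.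
    split; auto using 0.
Qed.

Lemma SigmaP_dummy B k m P : PiP k B m P -> SigmaP (S k) B m P.
Proof. intro H. apply SigmaP_from_not, PiP_dummy. now apply SigmaP_not. Qed.

Lemma hierarchy_up B k : forall m P,
  (SigmaP k B m P -> SigmaP (S k) B m P) /\ (PiP k B m P -> PiP (S k) B m P).
Proof.
  induction k; intros m P.
  - split; intro H.
    + apply SigmaP_dummy. destruct H as (f & H & ? & ?). exists f.
      inversion H; subst. split; [now constructor|auto].
    + apply PiP_dummy. destruct H as (f & H & ? & ?). exists f.
      inversion H; subst. split; [now constructor|auto].
  - assert (HS : forall P, SigmaP (S k) B m P -> SigmaP (S (S k)) B m P).
    { intros R HR. destruct (SigmaP_ex_inv _ _ _ HR) as (Q & HQ & E).
      apply SigmaP_iff with (fun e => exists a, Q (scons a e)).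
      - intro; now rewrite E.
      - apply SigmaP_ex. now apply IHk. }
    split; auto. intro H. apply PiP_from_not, HS. now apply SigmaP_not.
Qed.

Lemma DeltaP_up {B k m P} : DeltaP k B m P -> DeltaP (S k) B m P.
Proof. intros [H1 H2]. split; now apply hierarchy_up. Qed.

Lemma DeltaP_bounded {B k m P} f :
  bounded f -> scoped m 1 f -> (forall e, sat (fun _ => B) e f <-> P e) -> DeltaP k B m P.
Proof.
  intros. induction k; [|now apply DeltaP_up].
  split; exists f; (split; [now constructor|auto]).
Qed.

Lemma Delta0_DeltaP k B Y : Delta0 k B Y <-> DeltaP k B 1 (fun e => Y (e 0)).
Proof.
  assert (E : forall f e, scoped 1 1 f ->
    (sat (fun _ => B) (scons (e 0) (fun _ => 0)) f <-> sat (fun _ => B) e f)).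
  { intros f e Hf. apply (sat_ext 1 f 1); auto. intros [|i] Hi; [auto|lia]. }
  split.
  - intros [(f & ? & ? & Hf) (g & ? & ? & Hg)]. split.
    + exists f. split; [auto|split; [auto|]]. intro e. now rewrite Hf, E.
    + exists g. split; [auto|split; [auto|]]. intro e. now rewrite Hg, E.
  - intros [(f & ? & ? & Hf) (g & ? & ? & Hg)]. split.
    + exists f. split; [auto|split; [auto|]]. intro n. now rewrite Hf.
    + exists g. split; [auto|split; [auto|]]. intro n. now rewrite Hg.
Qed.

(** The polynomial bound is what makes composition possible: the value of a
    function can be introduced by a bounded quantifier. *)
Definition DeltaF k B m (F : (nat -> nat) -> nat) : Prop :=
  (exists t, tscoped m t /\ forall e, F e <= tval e t) /\
  DeltaP k B (S m) (fun e => e 0 = F (tl_env e)).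

Lemma DeltaP_bex {B k m} F P : DeltaF k B m F -> DeltaP k B (S m) P ->
  DeltaP k B m (fun e => exists a, a < F e /\ P (scons a e)).
Proof.
  intros [(t & Ht & Hb) HF] HP.
  assert (H1 : DeltaP k B (S m) (fun e => exists b, b < tval e (Add (tlift t) One) /\
      (fun e => e 0 = F (fun i => e (S (S i))) /\ e 1 < e 0) (scons b e))).
  { apply (cl_bex _ (DeltaP_closed B k) (S m) (Add (tlift t) One)
      (fun e => e 0 = F (fun i => e (S (S i))) /\ e 1 < e 0)).
    - split; [now apply tscoped_tlift|exact I].
    - apply (cl_and _ (DeltaP_closed B k)).
      + refine (DeltaP_iff _ _ (DeltaP_sub (S m)
          (fun i => match i with 0 => Var 0 | S i => Var (S (S i)) end) _ HF)).
        * intro; reflexivity.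
        * intros [|i] ?; simpl; lia.
      + apply (DeltaP_bounded (Lt (Var 1) (Var 0))); simpl; auto with arith. tauto. }
  refine (DeltaP_iff _ _ (cl_bex _ (DeltaP_closed B k) m t _ Ht (cl_and _ (DeltaP_closed B k) _ _ _ H1 HP))).
  intro e. simpl. split.
  - intros (a & ? & (b & ? & -> & ?) & ?). eauto.
  - intros (a & ? & ?). exists a. specialize (Hb e). repeat split; auto; [lia|].
    exists (F e). rewrite tval_tlift. repeat split; auto; lia.
Qed.

Lemma DeltaP_let {B k m} F Q : DeltaF k B m F -> DeltaP k B (S m) Q ->
  DeltaP k B m (fun e => Q (scons (F e) e)).
Proof.
  intros [(t & Ht & Hb) HF] HQ.
  refine (DeltaP_iff _ _ (cl_bex _ (DeltaP_closed B k) m (Add t One) _ (conj Ht I)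
    (cl_and _ (DeltaP_closed B k) _ _ _ HF HQ))).
  intro e. simpl. split.
  - intros (a & ? & -> & ?). auto.
  - intro. exists (F e). specialize (Hb e). repeat split; auto; lia.
Qed.

Lemma DeltaP_and {B k m P Q} : DeltaP k B m P -> DeltaP k B m Q -> DeltaP k B m (fun e => P e /\ Q e).
Proof. apply (cl_and _ (DeltaP_closed B k)). Qed.

Lemma DeltaP_or {B k m P Q} : DeltaP k B m P -> DeltaP k B m Q -> DeltaP k B m (fun e => P e \/ Q e).
Proof. apply (cl_or _ (DeltaP_closed B k)). Qed.

Lemma DeltaP_imp {B k m P Q} : DeltaP k B m P -> DeltaP k B m Q -> DeltaP k B m (fun e => P e -> Q e).
Proof.
  intros HP HQ. refine (DeltaP_iff _ _ (DeltaP_or (DeltaP_not HP) HQ)).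
  intro e. simpl. tauto.
Qed.

Lemma DeltaP_ball {B k m} F P : DeltaF k B m F -> DeltaP k B (S m) P ->
  DeltaP k B m (fun e => forall a, a < F e -> P (scons a e)).
Proof.
  intros HF HP. refine (DeltaP_iff _ _ (DeltaP_not (DeltaP_bex F _ HF (DeltaP_not HP)))).
  intro e. simpl. split.
  - intros H a Ha. apply NNPP. intro. apply H. eauto.
  - intros H (a & Ha & N). auto.
Qed.

Lemma DeltaF_shift {B k m F} : DeltaF k B m F -> DeltaF k B (S m) (fun e => F (tl_env e)).
Proof.
  intros [(t & Ht & Hb) HF]. split.
  - exists (tlift t). split; [now apply tscoped_tlift|].
    intro e. unfold tlift. now rewrite tval_tsub.
  - refine (DeltaP_iff _ _ (DeltaP_sub (S m)
          (fun i => match i with 0 => Var 0 | S i => Var (S (S i)) end) _ HF)).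
    + intro; reflexivity.
    + intros [|i] ?; simpl; lia.
Qed.

Lemma DeltaF_var B k m i : i < m -> DeltaF k B m (fun e => e i).
Proof.
  intro Hi. split.
  - exists (Var i). auto.
  - apply (DeltaP_bounded (Eq (Var 0) (Var (S i)))); simpl; auto with arith. tauto.
Qed.

Fixpoint numeral n : term := match n with 0 => Zero | S n => Add (numeral n) One end.

Lemma numeral_spec n : (forall m, tscoped m (numeral n)) /\ forall e, tval e (numeral n) = n.
Proof.
  induction n as [|n [H1 H2]]; simpl; auto. split; auto. intro e. rewrite H2. lia.
Qed.

Lemma DeltaF_const B k m n : DeltaF k B m (fun _ => n).
Proof.
  destruct (numeral_spec n) as [H1 H2]. split.
  - exists (numeral n). split; auto. intro e. now rewrite H2.
  - apply (DeltaP_bounded (Eq (Var 0) (numeral n))); simpl; auto with arith.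
    intro e. now rewrite H2.
Qed.

Lemma DeltaF_op {B k m F1 F2} (G : nat -> nat -> nat) (Gb : term -> term -> term) f :
  (forall t u, tscoped m t -> tscoped m u -> tscoped m (Gb t u)) ->
  (forall e t u a b, a <= tval e t -> b <= tval e u -> G a b <= tval e (Gb t u)) ->
  bounded f -> scoped 3 1 f ->
  (forall V e, sat V e f <-> e 2 = G (e 1) (e 0)) ->
  DeltaF k B m F1 -> DeltaF k B m F2 -> DeltaF k B m (fun e => G (F1 e) (F2 e)).
Proof.
  intros Hs Hb Hbf Hsf Hf H1 H2. split.
  - destruct H1 as [(t1 & ? & ?) _], H2 as [(t2 & ? & ?) _].
    exists (Gb t1 t2). auto.
  - apply (DeltaP_let (fun e => F1 (tl_env e))
      (fun e => e 1 = G (e 0) (F2 (fun i => e (S (S i)))))); [now apply DeltaF_shift|].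
    apply (DeltaP_let (fun e => F2 (fun i => e (S (S i))))
      (fun e => e 2 = G (e 1) (e 0)));
      [now apply (@DeltaF_shift B k (S m) (fun e => F2 (tl_env e))), DeltaF_shift|].
    refine (DeltaP_sub 3 Var _ _ (P := fun e => e 2 = G (e 1) (e 0))).
    + simpl; lia.
    + now apply (DeltaP_bounded f).
Qed.

Lemma DeltaF_add {B k m F G} : DeltaF k B m F -> DeltaF k B m G -> DeltaF k B m (fun e => F e + G e).
Proof.
  apply (DeltaF_op Nat.add Add (Eq (Var 2) (Add (Var 1) (Var 0)))); simpl; intros; try lia; auto.
Qed.

Lemma DeltaF_mul {B k m F G} : DeltaF k B m F -> DeltaF k B m G -> DeltaF k B m (fun e => F e * G e).
Proof.
  apply (DeltaF_op Nat.mul Mul (Eq (Var 2) (Mul (Var 1) (Var 0)))); simpl; intros; try lia; auto.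
  now apply Nat.mul_le_mono.
Qed.

Lemma DeltaF_npair {B k m F G} :
  DeltaF k B m F -> DeltaF k B m G -> DeltaF k B m (fun e => npair (F e) (G e)).
Proof.
  apply (DeltaF_op npair (fun t u => Add (Mul (Add t u) (Add (Add t u) One)) (Add u u))
    (Eq (Add (Var 2) (Var 2)) (Add (Mul (Add (Var 1) (Var 0)) (Add (Add (Var 1) (Var 0)) One))
      (Add (Var 0) (Var 0))))); simpl; auto 10 with arith; intros.
  - pose proof (npair_mono a b _ _ H H0).
    pose proof (npair_spec (tval e t) (tval e u)). lia.
  - pose proof (npair_spec (e 1) (e 0)). lia.
Qed.

Lemma DeltaF_S {B k m F} : DeltaF k B m F -> DeltaF k B m (fun e => S (F e)).
Proof.
  intro H. pose proof (DeltaF_add H (DeltaF_const B k m 1)) as H'.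
  destruct H' as [(t & ? & ?) H']. split.
  - exists t. split; auto. intro e. specialize (H1 e). lia.
  - refine (DeltaP_iff _ _ H'). intro. lia.
Qed.

Lemma DeltaP_eq {B k m F G} : DeltaF k B m F -> DeltaF k B m G -> DeltaP k B m (fun e => F e = G e).
Proof.
  intros HF [_ HG]. apply (DeltaP_let F (fun e => e 0 = G (tl_env e))); auto.
Qed.

Lemma DeltaP_lt {B k m F G} : DeltaF k B m F -> DeltaF k B m G -> DeltaP k B m (fun e => F e < G e).
Proof.
  intros HF HG. apply (DeltaP_let F (fun e => e 0 < G (tl_env e))); auto.
  apply (DeltaP_let (fun e => G (tl_env e)) (fun e => e 1 < e 0)); [now apply DeltaF_shift|].
  apply (DeltaP_bounded (Lt (Var 1) (Var 0))); simpl; auto with arith. tauto.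
Qed.

Lemma DeltaF_inv {B k m F} (G : nat -> nat) Q :
  (forall c, G c <= c) -> (forall d c, d = G c <-> Q d c) ->
  DeltaP k B 2 (fun e => Q (e 0) (e 1)) -> DeltaF k B m F -> DeltaF k B m (fun e => G (F e)).
Proof.
  intros Hle HQ HD HF. split.
  - destruct HF as [(t & ? & Hb) _]. exists t. split; auto.
    intro e. specialize (Hb e). specialize (Hle (F e)). lia.
  - apply (DeltaP_let (fun e => F (tl_env e)) (fun e => e 1 = G (e 0))); [now apply DeltaF_shift|].
    refine (DeltaP_iff _ _ (DeltaP_sub 2 (fun i => match i with 0 => Var 1 | _ => Var 0 end) _ HD)).
    + intro e. simpl. symmetry. apply HQ.
    + intros [|i]; simpl; lia.
Qed.

Lemma DeltaF_nfst {B k m F} : DeltaF k B m F -> DeltaF k B m (fun e => nfst (F e)).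
Proof.
  apply (DeltaF_inv nfst (fun d c => exists b, b < S c /\ c = npair d b)).
  - apply nfst_le.
  - intros d c. split.
    + intros ->. exists (nsnd c). pose proof (nsnd_le c). rewrite npair_eta. split; [lia|auto].
    + intros (b & _ & ->). now rewrite nfst_npair.
  - apply (DeltaP_bex (fun e => S (e 1)) (fun e => e 2 = npair (e 1) (e 0))).
    + apply DeltaF_S, DeltaF_var; lia.
    + apply DeltaP_eq; [apply DeltaF_var; lia|apply DeltaF_npair; apply DeltaF_var; lia].
Qed.

Lemma DeltaF_nsnd {B k m F} : DeltaF k B m F -> DeltaF k B m (fun e => nsnd (F e)).
Proof.
  apply (DeltaF_inv nsnd (fun d c => exists b, b < S c /\ c = npair b d)).
  - apply nsnd_le.
  - intros d c. split.
    + intros ->. exists (nfst c). pose proof (nfst_le c). rewrite npair_eta. split; [lia|auto].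
    + intros (b & _ & ->). now rewrite nsnd_npair.
  - apply (DeltaP_bex (fun e => S (e 1)) (fun e => e 2 = npair (e 0) (e 1))).
    + apply DeltaF_S, DeltaF_var; lia.
    + apply DeltaP_eq; [apply DeltaF_var; lia|apply DeltaF_npair; apply DeltaF_var; lia].
Qed.

Lemma DeltaP_set {B k m} (Y : natset) F :
  Delta0 k B Y -> DeltaF k B m F -> DeltaP k B m (fun e => Y (F e)).
Proof.
  intros HY HF. apply (DeltaP_let F (fun e => Y (e 0))); auto.
  refine (DeltaP_sub 1 Var _ _ (P := fun e => Y (e 0))); [simpl; lia|].
  now apply Delta0_DeltaP.
Qed.

Lemma DeltaP_app2 {B k m} (R : nat -> nat -> Prop) F G :
  DeltaP k B 2 (fun e => R (e 0) (e 1)) -> DeltaF k B m F -> DeltaF k B m G ->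
  DeltaP k B m (fun e => R (F e) (G e)).
Proof.
  intros HR HF HG. apply (DeltaP_let F (fun e => R (e 0) (G (tl_env e)))); auto.
  apply (DeltaP_let (fun e => G (tl_env e)) (fun e => R (e 1) (e 0))); [now apply DeltaF_shift|].
  refine (DeltaP_sub 2 (fun i => match i with 0 => Var 1 | _ => Var 0 end) _ HR).
  intros [|i]; simpl; lia.
Qed.

Lemma DeltaP_app3 {B k m} (R : nat -> nat -> nat -> Prop) F G H :
  DeltaP k B 3 (fun e => R (e 0) (e 1) (e 2)) -> DeltaF k B m F -> DeltaF k B m G -> DeltaF k B m H ->
  DeltaP k B m (fun e => R (F e) (G e) (H e)).
Proof.
  intros HR HF HG HH. apply (DeltaP_let F (fun e => R (e 0) (G (tl_env e)) (H (tl_env e)))); auto.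
  apply (DeltaP_let (fun e => G (tl_env e)) (fun e => R (e 1) (e 0) (H (fun i => e (S (S i))))));
    [now apply DeltaF_shift|].
  apply (DeltaP_let (fun e => H (fun i => e (S (S i)))) (fun e => R (e 2) (e 1) (e 0)));
    [now apply (@DeltaF_shift B k (S m) (fun e => H (tl_env e))), DeltaF_shift|].
  refine (DeltaP_sub 3 (fun i => match i with 0 => Var 2 | 1 => Var 1 | _ => Var 0 end) _ HR).
  intros [|[|i]]; simpl; lia.
Qed.

(** These tactics follow the shape of the function or of the relation. Under
    a binder the environment is shifted: variable 0 is the bound one. *)
Ltac deltaF := cbv beta; lazymatch goal with
  | |- DeltaF _ _ _ (fun _ => ?c) => apply DeltaF_const
  | |- DeltaF _ _ _ (fun e => e ?i) => apply DeltaF_var; lia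
  | |- DeltaF _ _ _ (fun e => S _) => apply DeltaF_S; deltaF
  | |- DeltaF _ _ _ (fun e => _ + _) => apply DeltaF_add; deltaF
  | |- DeltaF _ _ _ (fun e => _ * _) => apply DeltaF_mul; deltaF
  | |- DeltaF _ _ _ (fun e => npair _ _) => apply DeltaF_npair; deltaF
  | |- DeltaF _ _ _ (fun e => nfst _) => apply DeltaF_nfst; deltaF
  | |- DeltaF _ _ _ (fun e => nsnd _) => apply DeltaF_nsnd; deltaF
  | |- DeltaF _ _ _ _ => idtac
  end.

Ltac deltaP := cbv beta; lazymatch goal with
  | |- DeltaP _ _ _ (fun e => _ /\ _) => apply DeltaP_and; deltaP
  | |- DeltaP _ _ _ (fun e => _ \/ _) => apply DeltaP_or; deltaP
  | |- DeltaP _ _ _ (fun e => ~ _) => apply DeltaP_not; deltaP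
  | |- DeltaP _ _ _ (fun e => exists a, a < @?F e /\ @?R e a) =>
      apply (DeltaP_bex F (fun e => R (tl_env e) (e 0))); [deltaF|deltaP]
  | |- DeltaP _ _ _ (fun e => forall a, a < @?F e -> @?R e a) =>
      apply (DeltaP_ball F (fun e => R (tl_env e) (e 0))); [deltaF|deltaP]
  | |- DeltaP _ _ _ (fun e => _ -> _) => apply DeltaP_imp; deltaP
  | |- DeltaP _ _ _ (fun e => _ = _) => apply DeltaP_eq; deltaF
  | |- DeltaP _ _ _ (fun e => _ < _) => apply DeltaP_lt; deltaF
  | |- DeltaP _ _ _ (fun e => ?Y (@?F e)) => try (apply (DeltaP_set Y F); [eauto|deltaF])
  | |- _ => idtac
  end.

(** * Definability of sets *)

Lemma Delta0_refl k B : Delta0 k B B.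
Proof.
  apply Delta0_DeltaP. apply (DeltaP_bounded (Mem (Var 0) 0)); simpl; auto. tauto.
Qed.

Lemma Delta0_up k B Y : Delta0 k B Y -> Delta0 (S k) B Y.
Proof. rewrite !Delta0_DeltaP. apply DeltaP_up. Qed.

Lemma Delta0_le k l B Y : k <= l -> Delta0 k B Y -> Delta0 l B Y.
Proof. induction 1; auto using Delta0_up. Qed.

Lemma Delta0_join k B X Y : Delta0 k B X -> Delta0 k B Y -> Delta0 k B (X ⊕ Y).
Proof.
  intros HX HY. apply Delta0_DeltaP.
  refine (DeltaP_iff _ (P := fun e =>
    (exists d, d < S (e 0) /\ (e 0 = 2 * d /\ X d)) \/
    (exists d, d < S (e 0) /\ (e 0 = 2 * d + 1 /\ Y d))) _ _).
  - intro e. rewrite join_spec. split.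
    + intros [(d & ? & ? & ?)|(d & ? & ? & ?)]; eauto.
    + intros [(d & ? & ?)|(d & ? & ?)]; [left|right]; exists d; repeat split; auto; lia.
  - deltaP.
Qed.

Lemma Delta0_join_l k B X Y : Delta0 k B (X ⊕ Y) -> Delta0 k B X.
Proof.
  intro H. apply Delta0_DeltaP. refine (DeltaP_iff _ (P := fun e => (X ⊕ Y) (2 * e 0)) _ _).
  - intro. apply join_even.
  - deltaP.
Qed.

Lemma Delta0_join_r k B X Y : Delta0 k B (X ⊕ Y) -> Delta0 k B Y.
Proof.
  intro H. apply Delta0_DeltaP. refine (DeltaP_iff _ (P := fun e => (X ⊕ Y) (2 * e 0 + 1)) _ _).
  - intro. apply join_odd.
  - deltaP.
Qed.

Lemma DeltaF_tval {B k m t} : tscoped m t -> DeltaF k B m (fun e => tval e t).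
Proof.
  induction t; simpl; intro H; deltaF; intuition.
Qed.

Lemma DeltaP_sat_bounded k B l V f : forall m,
  bounded f -> scoped m l f -> (forall v, v < l -> Delta0 k B (V v)) ->
  DeltaP k B m (fun e => sat V e f).
Proof.
  induction f; simpl; intros m Hb Hs HV; try easy.
  - deltaP; now apply DeltaF_tval.
  - deltaP; now apply DeltaF_tval.
  - deltaP; now apply DeltaF_tval.
  - deltaP; now apply DeltaF_tval.
  - apply DeltaP_set; [apply HV|apply DeltaF_tval]; tauto.
  - apply DeltaP_not, DeltaP_set; [apply HV|apply DeltaF_tval]; tauto.
  - apply DeltaP_and; intuition.
  - apply DeltaP_or; intuition.
  - apply (DeltaP_ball (fun e => tval e t) (fun e => sat V e f)); [now apply DeltaF_tval|intuition].
  - apply (DeltaP_bex (fun e => tval e t) (fun e => sat V e f)); [now apply DeltaF_tval|intuition].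
Qed.

Lemma SigmaP_ex_SigmaP {B k m P} :
  SigmaP (S k) B (S m) P -> SigmaP (S k) B m (fun e => exists a, P (scons a e)).
Proof.
  intro H. destruct (SigmaP_ex_inv _ _ _ H) as (Q & HQ & E).
  (* both witnesses are bounded by a single one *)
  pose proof (PiP_closed_of_SigmaP k (@SigmaP_closed B k)) as C.
  set (s := fun i => match i with 0 => Var 0 | 1 => Var 1 | S (S i) => Var (3 + i) end).
  assert (Hs : forall i, i < S (S m) -> tscoped (S (S (S m))) (s i))
    by (intros [|[|i]]; simpl; lia).
  assert (H2 : tscoped (S (S m)) (Var 1)) by (simpl; lia).
  pose proof (cl_bex _ C (S m) (Var 0) _ (Nat.lt_0_succ m)
    (cl_bex _ C (S (S m)) (Var 1) (fun e => Q (fun i => tval e (s i)))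
      H2 (PiP_sub _ (S (S m)) _ _ s Hs HQ))) as H1.
  refine (SigmaP_iff _ _ _ _ _ (SigmaP_ex _ _ _ H1)).
  intro e. setoid_rewrite E. simpl.
  assert (E' : forall a b u,
      (fun i => tval (scons b (scons a (scons u e))) (s i)) = scons b (scons a e))
    by (intros; apply functional_extensionality; now intros [|[|i]]).
  setoid_rewrite E'. split.
  - intros (u & a & ? & b & ? & ?). eauto.
  - intros (a & b & ?). exists (S (a + b)), a. split; [lia|]. exists b. split; [lia|auto].
Qed.

(** Δ⁰₁ parameters do not raise the level k+1: the bounded matrix becomes a
    Δ⁰₁ relation, and of its two forms the one that begins with the innermost
    quantifier of the prefix is absorbed by that quantifier. *)
Lemma Delta01_trans k : forall B C m f,
  Delta0 1 C B -> scoped m 1 f ->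
  (Sigma0 (S k) f -> SigmaP (S k) C m (fun e => sat (fun _ => B) e f)) /\
  (Pi0 (S k) f -> PiP (S k) C m (fun e => sat (fun _ => B) e f)).
Proof.
  assert (HP : forall j, (forall B C m f, Delta0 1 C B -> scoped m 1 f ->
    Sigma0 j f -> SigmaP j C m (fun e => sat (fun _ => B) e f)) ->
    (forall B C m f, Delta0 1 C B -> scoped m 1 f ->
    Pi0 j f -> PiP j C m (fun e => sat (fun _ => B) e f))).
  { intros j H B C m f HB Hs Hf. apply PiP_from_not.
    refine (SigmaP_iff _ _ _ _ _ (H B C m (neg f) HB _ _)).
    - intro. apply sat_neg.
    - now apply scoped_neg.
    - now apply hierarchy_neg. }
  assert (HS : forall B C m f, Delta0 1 C B -> scoped m 1 f ->
    Sigma0 (S k) f -> SigmaP (S k) C m (fun e => sat (fun _ => B) e f)).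
  { induction k; intros B C m f HB Hs Hf; inversion Hf; subst; simpl.
    - apply (@SigmaP_ex_SigmaP C 0 m (fun e => sat (fun _ => B) e f0)).
      apply (DeltaP_sat_bounded 1 C 1 (fun _ => B)); auto; now inversion H0.
    - apply (@SigmaP_ex C (S k) m (fun e => sat (fun _ => B) e f0)).
      now apply (HP _ IHk). }
  intros B C m f HB Hs. split; intro Hf; auto.
Qed.

Lemma Delta0_trans k B C Y : Delta0 1 C B -> Delta0 (S k) B Y -> Delta0 (S k) C Y.
Proof.
  intros HB H. apply Delta0_DeltaP in H as [(f & Hf & Hs & E) (g & Hg & Hs' & E')].
  apply Delta0_DeltaP. split.
  - refine (SigmaP_iff _ _ _ _ E _). now apply (Delta01_trans k B C 1 f).
  - refine (PiP_iff _ _ _ _ E' _). now apply (Delta01_trans k B C 1 g).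
Qed.

Lemma Delta0_trans0 k B C Y : Delta0 0 C B -> Delta0 k B Y -> Delta0 k C Y.
Proof.
  intros HB H. destruct k as [|k].
  - apply Delta0_DeltaP in H as [(f & Hf & Hs & E) _]. apply Delta0_DeltaP.
    refine (DeltaP_iff _ E _). inversion Hf. now apply (DeltaP_sat_bounded 0 C 1 (fun _ => B)).
  - now apply (Delta0_trans k B C Y); [apply Delta0_up|].
Qed.

(** * Computability uniformly in the oracle *)

Fixpoint ecode m (e : nat -> nat) : nat :=
  match m with 0 => 0 | S m => npair (e 0) (ecode m (tl_env e)) end.

(** One program serves a whole family of oracles O i, and the computed function
    may mention the index i. The index can thus carry data that the oracle only
    codes, for instance the formula behind a Gödel number, and hypotheses that
    make a search terminate. *)
Definition Comp {I : Type} (O : I -> natset) m (F : I -> (nat -> nat) -> nat) : Prop :=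
  exists p, forall i e, eval (O i) p (ecode m e) (F i e).

Lemma Comp_ext {I} {O : I -> natset} {m F} G :
  (forall i e, F i e = G i e) -> Comp O m F -> Comp O m G.
Proof. intros H [p Hp]. exists p. intros. rewrite <- H. apply Hp. Qed.

Lemma Comp_unary {I} {O : I -> natset} {m F} (G : I -> nat -> nat) p :
  (forall i a, eval (O i) p a (G i a)) -> Comp O m F -> Comp O m (fun i e => G i (F i e)).
Proof. intros Hp [q Hq]. exists (PComp p q). intros. simpl. eauto. Qed.

Lemma Comp_nfst {I} {O : I -> natset} {m F} : Comp O m F -> Comp O m (fun i e => nfst (F i e)).
Proof. apply (Comp_unary (fun _ => nfst) PFst). reflexivity. Qed.

Lemma Comp_nsnd {I} {O : I -> natset} {m F} : Comp O m F -> Comp O m (fun i e => nsnd (F i e)).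
Proof. apply (Comp_unary (fun _ => nsnd) PSnd). reflexivity. Qed.

Lemma Comp_S {I} {O : I -> natset} {m F} : Comp O m F -> Comp O m (fun i e => S (F i e)).
Proof. apply (Comp_unary (fun _ => S) PSucc). reflexivity. Qed.

Lemma Comp_npair {I} {O : I -> natset} {m F G} :
  Comp O m F -> Comp O m G -> Comp O m (fun i e => npair (F i e) (G i e)).
Proof. intros [p Hp] [q Hq]. exists (PPair p q). intros. simpl. eauto. Qed.

Lemma Comp_const {I} (O : I -> natset) m n : Comp O m (fun _ _ => n).
Proof.
  induction n; [|now apply Comp_S]. exists PZero. reflexivity.
Qed.

Lemma Comp_code {I} (O : I -> natset) m : Comp O m (fun _ e => ecode m e).
Proof.
  exists (PPair PFst PSnd). intros. simpl. do 2 eexists. rewrite npair_eta. eauto.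
Qed.

Lemma Comp_var {I} (O : I -> natset) m : forall j, j < m -> Comp O m (fun _ e => e j).
Proof.
  intros j Hj.
  assert (H : forall j, exists p, forall X m e, j < m -> eval X p (ecode m e) (e j)).
  { clear. induction j as [|j [p Hp]].
    - exists PFst. intros X [|m] e H; [lia|]. simpl. now rewrite nfst_npair.
    - exists (PComp p PSnd). intros X [|m] e H; [lia|]. simpl. exists (ecode m (tl_env e)).
      rewrite nsnd_npair. split; auto. apply (Hp X m (tl_env e)). lia. }
  destruct (H j) as [p Hp]. exists p. auto.
Qed.

Lemma Comp_let {I} {O : I -> natset} {m} F G :
  Comp O m F -> Comp O (S m) G -> Comp O m (fun i e => G i (scons (F i e) e)).
Proof.
  intros HF [q Hq]. destruct (Comp_npair HF (Comp_code O m)) as [p Hp].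
  exists (PComp q p). intros i e. simpl. eexists. split; [apply Hp|].
  apply (Hq i (scons (F i e) e)).
Qed.

Lemma Comp_shift {I} {O : I -> natset} {m F} :
  Comp O m F -> Comp O (S m) (fun i e => F i (tl_env e)).
Proof.
  intros [q Hq]. exists (PComp q PSnd). intros i e. simpl.
  eexists. rewrite nsnd_npair. split; [reflexivity|]. apply (Hq i (tl_env e)).
Qed.

Fixpoint iter_rec (f : nat) (g : nat -> nat -> nat) (n : nat) : nat :=
  match n with 0 => f | S n => g n (iter_rec f g n) end.

Lemma Comp_rec {I} {O : I -> natset} {m} F G N :
  Comp O m F -> Comp O (S (S m)) G -> Comp O m N ->
  Comp O m (fun i e => iter_rec (F i e) (fun n r => G i (scons r (scons n e))) (N i e)).
Proof.
  intros [p Hp] [q Hq] HN.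
  destruct (Comp_npair (Comp_code O m) HN) as [a Ha].
  exists (PComp (PRec p (PComp q (PPair (PComp PSnd PSnd) (PPair (PComp PFst PSnd) PFst)))) a).
  intros i e. simpl. eexists. split; [apply Ha|]. rewrite nfst_npair, nsnd_npair.
  generalize (N i e). clear HN a Ha. induction n; simpl; auto.
  set (r := iter_rec _ _ n) in *. exists r. split; auto.
  eexists. split; [|apply (Hq i (scons r (scons n e)))].
  exists r, (npair n (ecode m e)). split; [|split; [|reflexivity]].
  - exists (npair n r). now rewrite !nsnd_npair.
  - exists n, (ecode m e). split; [|now rewrite nfst_npair].
    exists (npair n r). now rewrite nsnd_npair, nfst_npair.
Qed.

Lemma Comp_iter {I} {O : I -> natset} {m} F (g : nat -> nat) N :
  Comp O m F -> Comp O (S (S m)) (fun _ e => g (e 0)) -> Comp O m N ->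
  Comp O m (fun i e => Nat.iter (N i e) g (F i e)).
Proof.
  intros HF Hg HN. refine (Comp_ext _ _ (Comp_rec F (fun _ e => g (e 0)) N HF Hg HN)).
  intros i e. generalize (N i e). induction n; simpl; auto.
Qed.

Lemma Comp_add {I} {O : I -> natset} {m F G} :
  Comp O m F -> Comp O m G -> Comp O m (fun i e => F i e + G i e).
Proof.
  intros HF HG. refine (Comp_ext _ _ (Comp_iter F S G HF _ HG)).
  - intros i e. generalize (G i e). induction n; simpl; lia.
  - apply Comp_S, Comp_var. lia.
Qed.

Lemma Comp_mul {I} {O : I -> natset} {m F G} :
  Comp O m F -> Comp O m G -> Comp O m (fun i e => F i e * G i e).
Proof.
  intros HF HG.
  refine (Comp_ext _ _ (Comp_let F (fun i e => iter_rec 0 (fun n r => r + e 0) (G i (tl_env e))) HF _)).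
  - intros i e. simpl. change (G i (fun i0 => e i0)) with (G i e).
    generalize (G i e). induction n; simpl; [lia|]. rewrite IHn, Nat.mul_succ_r. lia.
  - pose proof (Comp_shift HG) as HG'.
    apply (Comp_rec (fun _ _ => 0) (fun _ e => e 0 + e 2) (fun i e => G i (tl_env e))); auto.
    + apply Comp_const.
    + apply Comp_add; apply Comp_var; lia.
Qed.

Lemma Comp_pred {I} {O : I -> natset} {m F} : Comp O m F -> Comp O m (fun i e => pred (F i e)).
Proof.
  intro HF. refine (Comp_ext _ _ (Comp_rec (fun _ _ => 0) (fun _ e => e 1) F _ _ HF)).
  - intros i e. now destruct (F i e).
  - apply Comp_const.
  - apply Comp_var. lia.
Qed.

Lemma Comp_sub {I} {O : I -> natset} {m F G} :
  Comp O m F -> Comp O m G -> Comp O m (fun i e => F i e - G i e).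
Proof.
  intros HF HG. refine (Comp_ext _ _ (Comp_iter F pred G HF _ HG)).
  - intros i e. generalize (G i e). induction n; simpl; lia.
  - apply Comp_pred, Comp_var. lia.
Qed.

Definition chi (P : Prop) : nat := if excluded_middle_informative P then 1 else 0.

Lemma chi_true (P : Prop) : P -> chi P = 1.
Proof. intro. unfold chi. now destruct (excluded_middle_informative P). Qed.

Lemma chi_false (P : Prop) : ~ P -> chi P = 0.
Proof. intro. unfold chi. now destruct (excluded_middle_informative P). Qed.

Ltac chi_case P :=
  let H := fresh in destruct (classic P) as [H|H];
  [rewrite !(chi_true P H)|rewrite !(chi_false P H)].

Definition Dec {I} (O : I -> natset) m (P : I -> (nat -> nat) -> Prop) : Prop :=
  Comp O m (fun i e => chi (P i e)).

Lemma Dec_iff {I} {O : I -> natset} {m P} Q :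
  (forall i e, P i e <-> Q i e) -> Dec O m P -> Dec O m Q.
Proof.
  intros H. apply Comp_ext. intros i e. specialize (H i e).
  chi_case (P i e); [rewrite chi_true|rewrite chi_false]; tauto.
Qed.

Lemma Dec_oracle {I} {O : I -> natset} {m F} : Comp O m F -> Dec O m (fun i e => O i (F i e)).
Proof.
  apply (Comp_unary (fun i a => chi (O i a)) POracle). intros i a. simpl.
  chi_case (O i a); auto.
Qed.

Lemma Dec_not {I} {O : I -> natset} {m P} : Dec O m P -> Dec O m (fun i e => ~ P i e).
Proof.
  intro H. refine (Comp_ext _ _ (Comp_sub (Comp_const O m 1) H)). intros i e. simpl.
  chi_case (P i e); [rewrite chi_false|rewrite chi_true]; auto.
Qed.

Lemma Dec_and {I} {O : I -> natset} {m P Q} :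
  Dec O m P -> Dec O m Q -> Dec O m (fun i e => P i e /\ Q i e).
Proof.
  intros HP HQ. refine (Comp_ext _ _ (Comp_mul HP HQ)). intros i e. simpl.
  chi_case (P i e); chi_case (Q i e); first [rewrite chi_true by tauto|rewrite chi_false by tauto]; auto.
Qed.

Lemma Dec_or {I} {O : I -> natset} {m P Q} :
  Dec O m P -> Dec O m Q -> Dec O m (fun i e => P i e \/ Q i e).
Proof.
  intros HP HQ. refine (Dec_iff _ _ (Dec_not (Dec_and (Dec_not HP) (Dec_not HQ)))).
  intros i e. simpl. tauto.
Qed.

Lemma Dec_imp {I} {O : I -> natset} {m P Q} :
  Dec O m P -> Dec O m Q -> Dec O m (fun i e => P i e -> Q i e).
Proof.
  intros HP HQ. refine (Dec_iff _ _ (Dec_or (Dec_not HP) HQ)).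
  intros i e. simpl. tauto.
Qed.

Lemma Dec_zero {I} {O : I -> natset} {m F} : Comp O m F -> Dec O m (fun i e => F i e = 0).
Proof.
  intro H. refine (Comp_ext _ _ (Comp_sub (Comp_const O m 1) H)). intros i e. simpl.
  destruct (F i e); [rewrite chi_true|rewrite chi_false]; auto.
Qed.

Lemma Dec_lt {I} {O : I -> natset} {m F G} :
  Comp O m F -> Comp O m G -> Dec O m (fun i e => F i e < G i e).
Proof.
  intros HF HG. refine (Dec_iff _ _ (Dec_not (Dec_zero (Comp_sub HG HF)))).
  intros i e. simpl. lia.
Qed.

Lemma Dec_eq {I} {O : I -> natset} {m F G} :
  Comp O m F -> Comp O m G -> Dec O m (fun i e => F i e = G i e).
Proof.
  intros HF HG. refine (Dec_iff _ _ (Dec_zero (Comp_add (Comp_sub HG HF) (Comp_sub HF HG)))).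
  intros i e. simpl. lia.
Qed.

Lemma Dec_let {I} {O : I -> natset} {m} F Q :
  Comp O m F -> Dec O (S m) Q -> Dec O m (fun i e => Q i (scons (F i e) e)).
Proof. intros HF HQ. apply (Comp_let F (fun i e => chi (Q i e))); auto. Qed.

Lemma Dec_bex {I} {O : I -> natset} {m} F Q : Comp O m F -> Dec O (S m) Q ->
  Dec O m (fun i e => exists a, a < F i e /\ Q i (scons a e)).
Proof.
  intros HF HQ.
  assert (HQ' : Dec O (S (S m)) (fun i e => Q i (scons (e 1) (fun i => e (S (S i)))))).
  { destruct HQ as [q Hq]. exists (PComp q PSnd). intros i e. simpl.
    eexists. rewrite nsnd_npair. split; [reflexivity|].
    apply (Hq i (scons (e 1) (fun i => e (S (S i))))). }
  refine (Dec_iff _ _ (Dec_not (Dec_zero (Comp_rec (fun _ _ => 0) _ F (Comp_const O m 0)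
    (Comp_add (Comp_var O (S (S m)) 0 _) HQ') HF)))); [|lia].
  intros i e. simpl. generalize (F i e). induction n; simpl.
  - split; [lia|intros (a & ? & _); lia].
  - change (Q i (scons n (fun i0 => e i0))) with (Q i (scons n e)).
    chi_case (Q i (scons n e)).
    + split; [|lia]. intros _. eauto.
    + rewrite Nat.add_0_r, IHn. split; intros (a & ? & ?).
      * exists a. split; [lia|auto].
      * exists a. split; [|auto]. assert (a <> n) by (intros ->; auto). lia.
Qed.

Lemma Dec_ball {I} {O : I -> natset} {m} F Q : Comp O m F -> Dec O (S m) Q ->
  Dec O m (fun i e => forall a, a < F i e -> Q i (scons a e)).
Proof.
  intros HF HQ. refine (Dec_iff _ _ (Dec_not (Dec_bex F _ HF (Dec_not HQ)))).
  intros i e. simpl. split.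
  - intros H a Ha. apply NNPP. intro. apply H. eauto.
  - intros H (a & Ha & N). auto.
Qed.

Lemma Comp_mu {I} {O : I -> natset} {m} Q F : Dec O (S m) Q ->
  (forall i e, Q i (scons (F i e) e)) ->
  (forall i e a, a < F i e -> ~ Q i (scons a e)) ->
  Comp O m F.
Proof.
  intros HQ H1 H2. destruct (Dec_not HQ) as [q Hq].
  assert (Hq' : forall i e a, eval (O i) (PComp q (PPair PSnd PFst)) (npair (ecode m e) a)
     (chi (~ Q i (scons a e)))).
  { intros i e a. simpl. eexists. split; [|apply (Hq i (scons a e))].
    simpl. exists a, (ecode m e). rewrite nfst_npair, nsnd_npair. auto. }
  exists (PMu (PComp q (PPair PSnd PFst))). intros i e.
  change (eval (O i) (PComp q (PPair PSnd PFst)) (npair (ecode m e) (F i e)) 0 /\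
    forall a, a < F i e -> exists v,
       eval (O i) (PComp q (PPair PSnd PFst)) (npair (ecode m e) a) (S v)).
  split.
  - specialize (Hq' i e (F i e)). rewrite chi_false in Hq'; auto.
  - intros a Ha. exists 0. specialize (Hq' i e a). rewrite chi_true in Hq'; auto.
Qed.

Lemma least_exists (P : nat -> Prop) : (exists n, P n) ->
  exists n, P n /\ forall a, a < n -> ~ P a.
Proof.
  intros [n Hn]. induction n as [n IH] using lt_wf_ind.
  destruct (classic (exists a, a < n /\ P a)) as [(a & Ha & H)|N]; [now apply (IH a)|].
  exists n. split; auto. intros a Ha H. apply N. eauto.
Qed.

Definition least (P : nat -> Prop) : nat :=
  epsilon (inhabits 0) (fun n => P n /\ forall a, a < n -> ~ P a).

Lemma least_spec P : (exists n, P n) -> P (least P) /\ forall a, a < least P -> ~ P a.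
Proof. intro H. unfold least. apply epsilon_spec. now apply least_exists. Qed.

(** It does not matter which a with Q the search finds, as each of them reveals
    whether P holds. *)
Lemma Dec_search {I} {O : I -> natset} {m} Q R P : Dec O (S m) Q -> Dec O (S m) R ->
  (forall i e, exists a, Q i (scons a e)) ->
  (forall i e a, Q i (scons a e) -> (P i e <-> R i (scons a e))) ->
  Dec O m P.
Proof.
  intros HQ HR HE HP.
  assert (HF : Comp O m (fun i e => least (fun a => Q i (scons a e)))).
  { apply (Comp_mu Q); auto; intros i e;
      destruct (least_spec _ (HE i e)) as [H1 H2]; auto. }
  refine (Dec_iff _ _ (Dec_let _ _ HF HR)). intros i e. simpl. symmetry.
  apply HP. now apply (least_spec (fun a => Q i (scons a e))).
Qed.

Lemma Dec_functional {I} (O Y : I -> natset) :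
  Dec O 1 (fun i e => Y i (e 0)) -> exists p, forall i, functional p (O i) (Y i).
Proof.
  intros [p Hp]. exists (PComp p (PPair (PPair PFst PSnd) PZero)). intros i n.
  pose proof (Hp i (fun _ => n)) as H. simpl in H.
  assert (E : forall r, eval (O i) p (npair n 0) r ->
    eval (O i) (PComp p (PPair (PPair PFst PSnd) PZero)) n r).
  { intros r Hr. simpl. exists (npair n 0). split; auto. exists n, 0. repeat split.
    exists (nfst n), (nsnd n). now rewrite npair_eta. }
  split; intro HY; apply E; rewrite ?(chi_true _ HY), ?(chi_false _ HY) in H; auto.
Qed.

Ltac comp := cbv beta; lazymatch goal with
  | |- Comp _ _ (fun _ _ => ?c) => apply Comp_const
  | |- Comp _ _ (fun _ e => e ?i) => apply Comp_var; lia
  | |- Comp _ _ (fun _ e => S _) => apply Comp_S; comp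
  | |- Comp _ _ (fun _ e => _ + _) => apply Comp_add; comp
  | |- Comp _ _ (fun _ e => _ * _) => apply Comp_mul; comp
  | |- Comp _ _ (fun _ e => _ - _) => apply Comp_sub; comp
  | |- Comp _ _ (fun _ e => pred _) => apply Comp_pred; comp
  | |- Comp _ _ (fun _ e => npair _ _) => apply Comp_npair; comp
  | |- Comp _ _ (fun _ e => nfst _) => apply Comp_nfst; comp
  | |- Comp _ _ (fun _ e => nsnd _) => apply Comp_nsnd; comp
  | |- Comp _ _ (fun i e => Nat.iter (@?N i e) ?g (@?F i e)) => apply (Comp_iter F g N); comp
  | |- _ => idtac
  end.

Ltac dec := cbv beta; lazymatch goal with
  | |- Dec _ _ (fun _ e => _ /\ _) => apply Dec_and; dec
  | |- Dec _ _ (fun _ e => _ \/ _) => apply Dec_or; dec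
  | |- Dec _ _ (fun _ e => ~ _) => apply Dec_not; dec
  | |- Dec _ _ (fun i e => exists a, a < @?F i e /\ @?R i e a) =>
      apply (Dec_bex F (fun i e => R i (tl_env e) (e 0))); [comp|dec]
  | |- Dec _ _ (fun i e => forall a, a < @?F i e -> @?R i e a) =>
      apply (Dec_ball F (fun i e => R i (tl_env e) (e 0))); [comp|dec]
  | |- Dec _ _ (fun i e => _ -> _) => apply Dec_imp; dec
  | |- Dec _ _ (fun i e => _ = _) => apply Dec_eq; comp
  | |- Dec _ _ (fun i e => _ < _) => apply Dec_lt; comp
  | |- _ => idtac
  end.

(** * Composition of programs *)

(** Composition of functionals: the queries to the oracle are answered by a
    program. *)
Fixpoint psubst (q p : program) : program :=
  match p with
  | POracle => q
  | PPair p1 p2 => PPair (psubst q p1) (psubst q p2)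
  | PComp p1 p2 => PComp (psubst q p1) (psubst q p2)
  | PRec p1 p2 => PRec (psubst q p1) (psubst q p2)
  | PMu p1 => PMu (psubst q p1)
  | _ => p
  end.

Lemma eval_psubst q X Y p : functional q X Y ->
  forall a r, eval Y p a r -> eval X (psubst q p) a r.
Proof.
  intro Hq. induction p; simpl; auto; intros a r.
  - intros [[H ->]|[H ->]]; now apply Hq.
  - intros (u & v & ? & ? & ?). exists u, v. auto.
  - intros (u & ? & ?). exists u. auto.
  - generalize (nfst a) as b, (nsnd a) as n. intros b n. revert r.
    induction n; simpl; auto. intros r (r' & ? & ?). exists r'. auto.
  - intros [H1 H2]. split; auto. intros i Hi. destruct (H2 i Hi). eauto.
Qed.

Lemma functional_psubst p q X Y Z :
  functional q X Y -> functional p Y Z -> functional (psubst q p) X Z.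
Proof. intros Hq Hp n. specialize (Hp n). split; intro; eapply eval_psubst; eauto; now apply Hp. Qed.

Lemma Dec_join {I} {O : I -> natset} {m} (X Y : I -> natset) F :
  Dec O 1 (fun i e => X i (e 0)) -> Dec O 1 (fun i e => Y i (e 0)) -> Comp O m F ->
  Dec O m (fun i e => (X i ⊕ Y i) (F i e)).
Proof.
  intros HX HY HF.
  assert (D : forall Z : I -> natset, Dec O 1 (fun i e => Z i (e 0)) -> forall m,
     Dec O (S m) (fun i e => Z i (e 0))).
  { intros Z [p Hp] m'.
    destruct (Comp_npair (Comp_var O (S m') 0 (Nat.lt_0_succ m')) (Comp_const O (S m') 0))
      as [q Hq].
    exists (PComp p q). intros i e. eexists. split; [apply Hq|]. apply (Hp i e). }
  refine (Dec_iff _ _ (P := fun i e =>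
    (exists a, a < S (F i e) /\ (F i e = 2 * a /\ X i a)) \/
    (exists a, a < S (F i e) /\ (F i e = 2 * a + 1 /\ Y i a))) _).
  - intros i e. rewrite join_spec. split.
    + intros [(a & ? & ? & ?)|(a & ? & ? & ?)]; eauto.
    + intros [(a & ? & ?)|(a & ? & ?)]; [left|right]; exists a; repeat split; auto; lia.
  - pose proof (Comp_shift HF) as HF'.
    dec; auto.
Qed.

Lemma Comp_weaken {I} {O : I -> natset} {F : I -> nat} m :
  Comp O 0 (fun i _ => F i) -> Comp O m (fun i _ => F i).
Proof.
  intros [p Hp]. exists (PComp p PZero). intros i e. exists 0. split; [reflexivity|].
  apply (Hp i (fun _ => 0)).
Qed.

Lemma Dec_app1 {I} {O : I -> natset} (R : I -> nat -> Prop) m F :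
  Dec O 1 (fun i e => R i (e 0)) -> Comp O m F -> Dec O m (fun i e => R i (F i e)).
Proof.
  intros [p Hp] HF. destruct (Comp_npair HF (Comp_const O m 0)) as [q Hq].
  exists (PComp p q). intros i e. eexists. split; [apply Hq|].
  apply (Hp i (fun _ => F i e)).
Qed.

Lemma Dec_app2 {I} {O : I -> natset} (R : I -> nat -> nat -> Prop) m F G :
  Dec O 2 (fun i e => R i (e 0) (e 1)) -> Comp O m F -> Comp O m G ->
  Dec O m (fun i e => R i (F i e) (G i e)).
Proof.
  intros [p Hp] HF HG.
  destruct (Comp_npair HF (Comp_npair HG (Comp_const O m 0))) as [q Hq].
  exists (PComp p q). intros i e. eexists. split; [apply Hq|].
  apply (Hp i (scons (F i e) (fun _ => G i e))).
Qed.

(** * Codes of finite sequences *)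

Fixpoint sdec_fuel n c : list nat :=
  match n, c with
  | S n, S c => nfst c :: sdec_fuel n (nsnd c)
  | _, _ => []
  end.

Definition sdec c : list nat := sdec_fuel c c.

Lemma seqcode_sdec_fuel n : forall c, c <= n -> seqcode (sdec_fuel n c) = c.
Proof.
  induction n; intros [|c] H; simpl; auto; [lia|].
  pose proof (nsnd_le c). rewrite IHn by lia. now rewrite npair_eta.
Qed.

Lemma seqcode_sdec c : seqcode (sdec c) = c.
Proof. now apply seqcode_sdec_fuel. Qed.

Lemma seqcode_inj : forall s s', seqcode s = seqcode s' -> s = s'.
Proof.
  induction s as [|a s IH]; intros [|b s'] H; simpl in H; try easy.
  injection H as H. apply npair_inj in H as [-> H]. f_equal. auto.
Qed.

Lemma sdec_seqcode s : sdec (seqcode s) = s.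
Proof. apply seqcode_inj, seqcode_sdec. Qed.

Lemma treeset_sdec T c : treeset T c <-> T (sdec c).
Proof.
  split.
  - intros (s & -> & H). now rewrite sdec_seqcode.
  - intro H. exists (sdec c). now rewrite seqcode_sdec.
Qed.

Lemma treeset_seqcode T s : treeset T (seqcode s) <-> T s.
Proof. now rewrite treeset_sdec, sdec_seqcode. Qed.

Notation slen c := (length (sdec c)).
Notation snth c j := (nth j (sdec c) 0).
Notation stail := (fun c => nsnd (pred c)).

Lemma stail_iter j : forall c, Nat.iter j stail c = seqcode (skipn j (sdec c)).
Proof.
  induction j; intro c; simpl; [now rewrite seqcode_sdec|].
  rewrite IHj. clear IHj. generalize (sdec c).
  induction j; intros [|a l]; simpl; auto.
  now rewrite nsnd_npair.
Qed.

Lemma Comp_snth {I} {O : I -> natset} {m F G} : Comp O m F -> Comp O m G ->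
  Comp O m (fun i e => snth (F i e) (G i e)).
Proof.
  intros HF HG. refine (Comp_ext (F := fun i e => nfst (pred (Nat.iter (G i e) stail (F i e)))) _ _ _).
  - intros i e. rewrite stail_iter. generalize (G i e) (sdec (F i e)).
    intros n. induction n; intros [|a l]; simpl; auto. apply nfst_npair.
  - comp; auto.
Qed.

Lemma Comp_slen {I} {O : I -> natset} {m F} : Comp O m F -> Comp O m (fun i e => slen (F i e)).
Proof.
  intros HF. apply (Comp_let F (fun i e => slen (e 0))); auto.
  apply (Comp_mu (fun i e => Nat.iter (e 0) stail (e 1) = 0)).
  - dec.
  - intros i e. rewrite stail_iter. simpl. now rewrite skipn_all.
  - intros i e a Ha. simpl. rewrite stail_iter.
    pose proof (length_skipn a (sdec (e 0))). intro H'.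
    destruct (skipn a (sdec (e 0))); simpl in *; lia.
Qed.

Lemma seqcode_app_r s t : seqcode t <= seqcode (s ++ t).
Proof.
  induction s as [|a s IH]; simpl; auto. pose proof (npair_ge a (seqcode (s ++ t))). lia.
Qed.

Lemma seqcode_In x s : In x s -> x < seqcode s.
Proof.
  induction s as [|a s IH]; simpl; [easy|].
  pose proof (npair_ge a (seqcode s)). intros [->|H']; [lia|]. apply IH in H'. lia.
Qed.

(** * Truth of bounded formulas is decidable *)

(** Every number codes an environment; 0 codes the constant environment 0. *)
Definition envlook c i : nat := nfst (Nat.iter i nsnd c).

Lemma envlook_cons a c : envlook (npair a c) = scons a (envlook c).
Proof.
  apply functional_extensionality. intros [|i]; unfold envlook; simpl.
  - apply nfst_npair.
  - f_equal. induction i; simpl; [apply nsnd_npair|]. now rewrite IHi.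
Qed.

Lemma envlook_0 : envlook 0 = fun _ => 0.
Proof.
  apply functional_extensionality. intro i. unfold envlook.
  assert (H : Nat.iter i nsnd 0 = 0) by (induction i; simpl; [auto|now rewrite IHi]).
  now rewrite H.
Qed.

(** A truth table is a code of a finite list of entries. An entry says that the
    term (k = 0) or the formula (k = 1) with Gödel number g has the value v in
    the environment coded by c; the value of a formula is 1 or 0. *)
Definition entry k g c v : nat := npair k (npair g (npair c v)).
Definition has w x : Prop := In x (sdec w).
Definition tv (v : nat) (P : Prop) : Prop := (P /\ v = 1) \/ (~ P /\ v = 0).

Definition args w k g c (Q : nat -> nat -> Prop) : Prop :=
  exists u, u < w /\ (exists z, z < w /\
    (has w (entry k (nfst (nsnd g)) c u) /\ has w (entry k (nsnd (nsnd g)) c z) /\ Q u z)).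

Definition arg w g (Q : nat -> Prop) c : Prop :=
  exists u, u < w /\ (has w (entry 0 (nfst (nsnd g)) c u) /\ Q u).

(** The entry (k,g,c,v) agrees with entries of the table w for the immediate
    parts of g. Its quantifiers are bounded in terms of w, so it is decidable, and
    it is positive in w, so that it survives when the table is extended. Since the clauses for
    the bounded quantifiers must be positive too, their two truth values are
    treated by separate alternatives. *)
Definition just (V0 V1 : natset) w k g c v : Prop :=
  (k = 0 /\ nfst g = 0 /\ v = envlook c (nsnd g)) \/
  (k = 0 /\ nfst g = 1 /\ v = 0) \/
  (k = 0 /\ nfst g = 2 /\ v = 1) \/
  (k = 0 /\ nfst g = 3 /\ args w 0 g c (fun u z => v = u + z)) \/
  (k = 0 /\ nfst g = 4 /\ args w 0 g c (fun u z => v = u * z)) \/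
  (k = 1 /\ nfst g = 0 /\ args w 0 g c (fun u z => tv v (u = z))) \/
  (k = 1 /\ nfst g = 1 /\ args w 0 g c (fun u z => tv v (~ u = z))) \/
  (k = 1 /\ nfst g = 2 /\ args w 0 g c (fun u z => tv v (u < z))) \/
  (k = 1 /\ nfst g = 3 /\ args w 0 g c (fun u z => tv v (~ u < z))) \/
  (k = 1 /\ nfst g = 4 /\ arg w g (fun u => tv v
    ((nsnd (nsnd g) = 0 /\ V0 u) \/ (~ nsnd (nsnd g) = 0 /\ V1 u))) c) \/
  (k = 1 /\ nfst g = 5 /\ arg w g (fun u => tv v (~
    ((nsnd (nsnd g) = 0 /\ V0 u) \/ (~ nsnd (nsnd g) = 0 /\ V1 u)))) c) \/
  (k = 1 /\ nfst g = 6 /\ args w 1 g c (fun u z => tv v (u = 1 /\ z = 1))) \/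
  (k = 1 /\ nfst g = 7 /\ args w 1 g c (fun u z => tv v (u = 1 \/ z = 1))) \/
  (k = 1 /\ nfst g = 8 /\ arg w g (fun b =>
    (v = 1 /\ forall a, a < b -> has w (entry 1 (nsnd (nsnd g)) (npair a c) 1)) \/
    (v = 0 /\ exists a, a < b /\ has w (entry 1 (nsnd (nsnd g)) (npair a c) 0))) c) \/
  (k = 1 /\ nfst g = 9 /\ arg w g (fun b =>
    (v = 0 /\ forall a, a < b -> has w (entry 1 (nsnd (nsnd g)) (npair a c) 0)) \/
    (v = 1 /\ exists a, a < b /\ has w (entry 1 (nsnd (nsnd g)) (npair a c) 1))) c).

Definition valid (V0 V1 : natset) w : Prop :=
  forall k g c v, has w (entry k g c v) -> just V0 V1 w k g c v.

Definition sel (V0 V1 : natset) : nat -> natset := fun v => match v with 0 => V0 | _ => V1 end.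

Lemma sel_spec V0 V1 v u :
  (v = 0 /\ V0 u) \/ (~ v = 0 /\ V1 u) <-> sel V0 V1 v u.
Proof. destruct v; simpl; intuition discriminate. Qed.

Lemma tv_iff v P Q : (P <-> Q) -> tv v P <-> tv v Q.
Proof. unfold tv. tauto. Qed.

(** Only the clause of [just] with the right tag can apply. *)
Ltac just_inv H :=
  unfold just in H; simpl in H;
  rewrite ?nfst_npair, ?nsnd_npair in H;
  repeat match type of H with
  | _ \/ _ => destruct H as [H|H]; [try solve [exfalso; destruct H as (? & ? & _); discriminate]|]
  end;
  try solve [exfalso; destruct H as (? & ? & _); discriminate];
  destruct H as (_ & _ & H); unfold args, arg in H;
  rewrite ?nsnd_npair in H; rewrite ?nfst_npair, ?nsnd_npair in H.

Lemma valid_term V0 V1 w : valid V0 V1 w -> forall t c v,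
  has w (entry 0 (tgodel t) c v) -> v = tval (envlook c) t.
Proof.
  intros Hw. induction t; intros c v H; apply Hw in H; just_inv H; auto;
  destruct H as (u & _ & z & _ & H1 & H2 & ->); simpl;
  apply IHt1 in H1; apply IHt2 in H2; congruence.
Qed.

(** Whatever a valid table says is true, because truth is determined by
    recursion on the formula. *)
Lemma valid_formula V0 V1 w : valid V0 V1 w -> forall f c v,
  bounded f -> has w (entry 1 (godel f) c v) -> tv v (sat (sel V0 V1) (envlook c) f).
Proof.
  intros Hw. pose proof (valid_term _ _ _ Hw) as Ht.
  induction f; intros c w' Hb H; simpl in Hb; try easy; apply Hw in H; just_inv H; simpl.
  1-4: destruct H as (u & _ & z & _ & H1 & H2 & H); apply Ht in H1; apply Ht in H2;
    subst; exact H.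
  1-2: destruct H as (u & _ & H1 & H); apply Ht in H1; subst u.
  - revert H. apply tv_iff. symmetry. apply sel_spec.
  - revert H. apply tv_iff. rewrite sel_spec. reflexivity.
  - destruct H as (u & _ & z & _ & H1 & H2 & H).
    apply IHf1 in H1; [|tauto]. apply IHf2 in H2; [|tauto].
    revert H. apply tv_iff. unfold tv in *. intuition lia.
  - destruct H as (u & _ & z & _ & H1 & H2 & H).
    apply IHf1 in H1; [|tauto]. apply IHf2 in H2; [|tauto].
    revert H. apply tv_iff. unfold tv in *. intuition lia.
  - destruct H as (b & _ & H1 & H). apply Ht in H1. subst b.
    destruct H as [[-> H]|[-> (a & Ha & H)]].
    + left. split; auto. intros a Ha. specialize (H a Ha). apply IHf in H; auto.
      rewrite envlook_cons in H. unfold tv in H. intuition lia.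
    + right. split; auto. intro N. specialize (N a Ha). apply IHf in H; auto.
      rewrite envlook_cons in H. unfold tv in H. intuition lia.
  - destruct H as (b & _ & H1 & H). apply Ht in H1. subst b.
    destruct H as [[-> H]|[-> (a & Ha & H)]].
    + right. split; auto. intros (a & Ha & N). specialize (H a Ha). apply IHf in H; auto.
      rewrite envlook_cons in H. unfold tv in H. intuition lia.
    + left. split; auto. exists a. split; auto. apply IHf in H; auto.
      rewrite envlook_cons in H. unfold tv in H. intuition lia.
Qed.

Definition sub_table w w' : Prop := w <= w' /\ forall x, has w x -> has w' x.

Lemma args_mono w w' k g c Q : sub_table w w' -> args w k g c Q -> args w' k g c Q.
Proof.
  intros [Hle Hs] (u & Hu & z & Hz & ? & ? & ?).
  exists u. split; [lia|]. exists z. split; [lia|]. auto.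
Qed.

Lemma arg_mono w w' g c (Q Q' : nat -> Prop) : sub_table w w' ->
  (forall u, Q u -> Q' u) -> arg w g Q c -> arg w' g Q' c.
Proof.
  intros [Hle Hs] HQ (u & Hu & ? & ?). exists u. split; [lia|]. auto.
Qed.

Lemma just_mono V0 V1 w w' k g c v : sub_table w w' ->
  just V0 V1 w k g c v -> just V0 V1 w' k g c v.
Proof.
  intros Hw. unfold just.
  pose proof (fun k Q => args_mono w w' k g c Q Hw) as Ha.
  pose proof (fun Q Q' => arg_mono w w' g c Q Q' Hw) as Hb.
  destruct Hw as [_ Hw].
  repeat match goal with |- (?A \/ ?B) -> _ => intros [H|H]; [left|right; revert H] end.
  all: try exact H.
  all: try (destruct H as (? & ? & H); repeat split; auto; revert H; apply Ha).
  all: try (destruct H as (? & ? & H); repeat split; auto; revert H; apply Hb; auto).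
  - intros u [[? H]|[? (a & ? & ?)]]; [left|right]; eauto.
  - intros (? & ? & H); repeat split; auto; revert H; apply Hb.
    intros u [[? H]|[? (a & ? & ?)]]; [left|right]; eauto.
Qed.

Lemma entry_inj k g c v k' g' c' v' :
  entry k g c v = entry k' g' c' v' -> k = k' /\ g = g' /\ c = c' /\ v = v'.
Proof.
  unfold entry. intro H. apply npair_inj in H as [-> H].
  apply npair_inj in H as [-> H]. apply npair_inj in H as [-> ->]. auto.
Qed.

Lemma valid_add V0 V1 w k g c v : valid V0 V1 w -> just V0 V1 w k g c v ->
  exists z, valid V0 V1 z /\ sub_table w z /\ has z (entry k g c v).
Proof.
  intros H Hj. set (z := seqcode (entry k g c v :: sdec w)).
  assert (S1 : sub_table w z).
  { split.
    - rewrite <- (seqcode_sdec w). apply (seqcode_app_r [entry k g c v]).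
    - intros x Hx. unfold has, z. rewrite sdec_seqcode. now right. }
  exists z. split; [|split; auto].
  - intros k' g' c' v' Hx. unfold has, z in Hx. rewrite sdec_seqcode in Hx.
    destruct Hx as [Hx|Hx].
    + apply entry_inj in Hx as (-> & -> & -> & ->). now apply just_mono with w.
    + apply just_mono with w; auto.
  - unfold has, z. rewrite sdec_seqcode. now left.
Qed.

Lemma has_lt w k g c v : has w (entry k g c v) -> v < w.
Proof.
  intro H. apply seqcode_In in H. rewrite seqcode_sdec in H. unfold entry in H.
  pose proof (npair_ge k (npair g (npair c v))).
  pose proof (npair_ge g (npair c v)). pose proof (npair_ge c v). lia.
Qed.

Ltac just_clause := unfold just, entry; simpl; rewrite ?nfst_npair, ?nsnd_npair;
  unfold args, arg; rewrite ?nsnd_npair; rewrite ?nfst_npair, ?nsnd_npair.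

Lemma table_term V0 V1 t : forall c w, valid V0 V1 w ->
  exists z, valid V0 V1 z /\ sub_table w z /\ has z (entry 0 (tgodel t) c (tval (envlook c) t)).
Proof.
  induction t; intros c w Hw.
  - apply valid_add; auto. just_clause. tauto.
  - apply valid_add; auto. just_clause. tauto.
  - apply valid_add; auto. just_clause. tauto.
  - destruct (IHt1 c w Hw) as (w1 & Hw1 & S1 & H1).
    destruct (IHt2 c w1 Hw1) as (w2 & Hw2 & S2 & H2).
    apply S2 in H1.
    destruct (valid_add _ _ w2 0 (tgodel (Add t1 t2)) c (tval (envlook c) (Add t1 t2)) Hw2)
      as (w3 & ? & S3 & ?).
    + just_clause. do 3 right. left. repeat split.
      exists (tval (envlook c) t1). split; [eapply has_lt; eauto|].
      exists (tval (envlook c) t2). split; [eapply has_lt; eauto|]. auto.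
    + exists w3. split; auto. split; auto. split; [destruct S1, S2, S3; lia|].
      intros; apply S3, S2, S1; auto.
  - destruct (IHt1 c w Hw) as (w1 & Hw1 & S1 & H1).
    destruct (IHt2 c w1 Hw1) as (w2 & Hw2 & S2 & H2).
    apply S2 in H1.
    destruct (valid_add _ _ w2 0 (tgodel (Mul t1 t2)) c (tval (envlook c) (Mul t1 t2)) Hw2)
      as (w3 & ? & S3 & ?).
    + just_clause. do 4 right. left. repeat split.
      exists (tval (envlook c) t1). split; [eapply has_lt; eauto|].
      exists (tval (envlook c) t2). split; [eapply has_lt; eauto|]. auto.
    + exists w3. split; auto. split; auto. split; [destruct S1, S2, S3; lia|].
      intros; apply S3, S2, S1; auto.
Qed.

Lemma sub_table_trans w w' w'' : sub_table w w' -> sub_table w' w'' -> sub_table w w''.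
Proof. intros [? ?] [? ?]. split; [lia|auto]. Qed.

Lemma tv_ex P : exists v, tv v P.
Proof. unfold tv. destruct (classic P); [exists 1|exists 0]; tauto. Qed.

(** The search for a table succeeds: tables for the parts, and for all the
    instances under a bounded quantifier, are accumulated into one. *)
Lemma table_formula V0 V1 f : forall c w, bounded f -> valid V0 V1 w ->
  exists z, valid V0 V1 z /\ sub_table w z /\ exists v, has z (entry 1 (godel f) c v).
Proof.
  assert (Add1 : forall w w1 f c v, sub_table w w1 -> valid V0 V1 w1 ->
    just V0 V1 w1 1 (godel f) c v ->
    exists z, valid V0 V1 z /\ sub_table w z /\ exists v, has z (entry 1 (godel f) c v)).
  { intros w w1 g c v S1 Hw1 Hj.
    destruct (valid_add _ _ _ _ _ _ _ Hw1 Hj) as (z & ? & ? & ?).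
    exists z. split; auto. split; [eapply sub_table_trans; eauto|eauto]. }
  assert (Terms : forall t s c w, valid V0 V1 w -> exists z, valid V0 V1 z /\ sub_table w z /\
    has z (entry 0 (tgodel t) c (tval (envlook c) t)) /\
    has z (entry 0 (tgodel s) c (tval (envlook c) s))).
  { intros t s c w Hw. destruct (table_term V0 V1 t c w Hw) as (w1 & Hw1 & S1 & H1).
    destruct (table_term V0 V1 s c w1 Hw1) as (w2 & Hw2 & S2 & H2).
    exists w2. split; auto. split; [eapply sub_table_trans; eauto|]. split; auto. now apply S2. }
  assert (Rows : forall t g, (forall c w, valid V0 V1 w -> exists z, valid V0 V1 z /\
      sub_table w z /\ exists v, has z (entry 1 (godel g) c v)) ->
    forall c w, valid V0 V1 w -> exists z, valid V0 V1 z /\ sub_table w z /\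
      has z (entry 0 (tgodel t) c (tval (envlook c) t)) /\
      forall a, a < tval (envlook c) t -> exists v, has z (entry 1 (godel g) (npair a c) v)).
  { intros t g IH c w Hw. destruct (table_term V0 V1 t c w Hw) as (w1 & Hw1 & S1 & H1).
    assert (HB : forall b, exists z, valid V0 V1 z /\ sub_table w1 z /\
      forall a, a < b -> exists v, has z (entry 1 (godel g) (npair a c) v)).
    { induction b as [|b (z & Hz & Sz & H)].
      - exists w1. split; auto. split; [split; auto|]. lia.
      - destruct (IH (npair b c) z Hz) as (z' & ? & S' & v & ?).
        exists z'. split; auto. split; [eapply sub_table_trans; eauto|].
        intros a Ha. destruct (Nat.eq_dec a b) as [->|]; [eauto|].
        destruct (H a) as [v' ?]; [lia|]. exists v'. now apply S'. }
    destruct (HB (tval (envlook c) t)) as (z & Hz & Sz & H).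
    exists z. split; auto. split; [eapply sub_table_trans; eauto|]. split; auto. now apply Sz. }
  induction f; intros c w Hb Hw; simpl in Hb; try easy.
  1-4: destruct (Terms t s c w Hw) as (w1 & Hw1 & S1 & H1 & H2).
  - destruct (tv_ex (tval (envlook c) t = tval (envlook c) s)) as [v' Hv].
    apply (Add1 w w1 _ _ v'); auto. just_clause. do 5 right. left. repeat split.
    exists (tval (envlook c) t). split; [eapply has_lt; eauto|].
    exists (tval (envlook c) s). split; [eapply has_lt; eauto|]. eauto.
  - destruct (tv_ex (~ tval (envlook c) t = tval (envlook c) s)) as [v' Hv].
    apply (Add1 w w1 _ _ v'); auto. just_clause. do 6 right. left. repeat split.
    exists (tval (envlook c) t). split; [eapply has_lt; eauto|].
    exists (tval (envlook c) s). split; [eapply has_lt; eauto|]. eauto.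
  - destruct (tv_ex (tval (envlook c) t < tval (envlook c) s)) as [v' Hv].
    apply (Add1 w w1 _ _ v'); auto. just_clause. do 7 right. left. repeat split.
    exists (tval (envlook c) t). split; [eapply has_lt; eauto|].
    exists (tval (envlook c) s). split; [eapply has_lt; eauto|]. eauto.
  - destruct (tv_ex (~ tval (envlook c) t < tval (envlook c) s)) as [v' Hv].
    apply (Add1 w w1 _ _ v'); auto. just_clause. do 8 right. left. repeat split.
    exists (tval (envlook c) t). split; [eapply has_lt; eauto|].
    exists (tval (envlook c) s). split; [eapply has_lt; eauto|]. eauto.
  - destruct (table_term V0 V1 t c w Hw) as (w1 & Hw1 & S1 & H1).
    edestruct tv_ex as [v' Hv].
    apply (Add1 w w1 _ _ v'); auto. just_clause. do 9 right. left. repeat split.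
    eexists; split; [eapply has_lt; eauto|]. eauto.
  - destruct (table_term V0 V1 t c w Hw) as (w1 & Hw1 & S1 & H1).
    edestruct tv_ex as [v' Hv].
    apply (Add1 w w1 _ _ v'); auto. just_clause. do 10 right. left. repeat split.
    eexists; split; [eapply has_lt; eauto|]. eauto.
  - destruct (IHf1 c w ltac:(tauto) Hw) as (w1 & Hw1 & S1 & u & H1).
    destruct (IHf2 c w1 ltac:(tauto) Hw1) as (w2 & Hw2 & S2 & z & H2).
    apply S2 in H1. destruct (tv_ex (u = 1 /\ z = 1)) as [v' Hv].
    apply (Add1 w w2 _ _ v'); auto; [eapply sub_table_trans; eauto|].
    just_clause. do 11 right. left. repeat split.
    exists u. split; [eapply has_lt; eauto|]. exists z. split; [eapply has_lt; eauto|]. auto.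
  - destruct (IHf1 c w ltac:(tauto) Hw) as (w1 & Hw1 & S1 & u & H1).
    destruct (IHf2 c w1 ltac:(tauto) Hw1) as (w2 & Hw2 & S2 & z & H2).
    apply S2 in H1. destruct (tv_ex (u = 1 \/ z = 1)) as [v' Hv].
    apply (Add1 w w2 _ _ v'); auto; [eapply sub_table_trans; eauto|].
    just_clause. do 12 right. left. repeat split.
    exists u. split; [eapply has_lt; eauto|]. exists z. split; [eapply has_lt; eauto|]. auto.
  - destruct (Rows t f (fun c w => IHf c w Hb) c w Hw) as (z & Hz & Sz & H1 & H).
    assert (exists v, just V0 V1 z 1 (godel (BAll t f)) c v) as [v Hv].
    { destruct (classic (exists a, a < tval (envlook c) t /\ has z (entry 1 (godel f) (npair a c) 0)))
        as [E|E].
      - exists 0. just_clause. do 13 right. left. repeat split.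
        eexists; split; [eapply has_lt; eauto|]. eauto.
      - exists 1. just_clause. do 13 right. left. repeat split.
        eexists; split; [eapply has_lt; eauto|]. split; [eauto|]. left. split; auto.
        intros a Ha. destruct (H a Ha) as [v Hv].
        pose proof (valid_formula _ _ _ Hz f _ _ Hb Hv) as T. unfold tv in T.
        destruct T as [[_ ->]|[_ ->]]; auto. exfalso. eauto. }
    apply (Add1 w z _ _ v); auto.
  - destruct (Rows t f (fun c w => IHf c w Hb) c w Hw) as (z & Hz & Sz & H1 & H).
    assert (exists v, just V0 V1 z 1 (godel (BEx t f)) c v) as [v Hv].
    { destruct (classic (exists a, a < tval (envlook c) t /\ has z (entry 1 (godel f) (npair a c) 1)))
        as [E|E].
      - exists 1. just_clause. do 14 right. repeat split.
        eexists; split; [eapply has_lt; eauto|]. eauto.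
      - exists 0. just_clause. do 14 right. repeat split.
        eexists; split; [eapply has_lt; eauto|]. split; [eauto|]. left. split; auto.
        intros a Ha. destruct (H a Ha) as [v Hv].
        pose proof (valid_formula _ _ _ Hz f _ _ Hb Hv) as T. unfold tv in T.
        destruct T as [[_ ->]|[_ ->]]; auto. exfalso. eauto. }
    apply (Add1 w z _ _ v); auto.
Qed.

Lemma valid_empty V0 V1 : valid V0 V1 0.
Proof. intros k g c v []. Qed.

Lemma Comp_entry {I} {O : I -> natset} {m K G C V} :
  Comp O m K -> Comp O m G -> Comp O m C -> Comp O m V ->
  Comp O m (fun i e => entry (K i e) (G i e) (C i e) (V i e)).
Proof. intros. unfold entry. comp; auto. Qed.

Lemma Dec_has {I} {O : I -> natset} {m W X} :
  Comp O m W -> Comp O m X -> Dec O m (fun i e => has (W i e) (X i e)).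
Proof.
  apply (Dec_app2 (fun _ => has)).
  refine (Dec_iff _ _ (P := fun i e =>
    exists j, j < slen (e 0) /\ snth (e 0) j = e 1) _).
  - intros i e. unfold has. split.
    + intros (j & Hj & <-). now apply nth_In.
    + intro H. destruct (In_nth _ _ 0 H) as (j & ? & ?). eauto.
  - dec; first [apply Comp_slen|apply Comp_snth]; comp.
Qed.

Lemma valid_iff V0 V1 w : valid V0 V1 w <->
  forall j, j < slen w -> just V0 V1 w (nfst (snth w j)) (nfst (nsnd (snth w j)))
    (nfst (nsnd (nsnd (snth w j)))) (nsnd (nsnd (nsnd (snth w j)))).
Proof.
  split.
  - intros H j Hj. apply H. unfold entry. rewrite !npair_eta. now apply nth_In.
  - intros H k g c v Hx. destruct (In_nth _ _ 0 Hx) as (j & Hj & E).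
    specialize (H j Hj). rewrite E in H. unfold entry in H.
    now rewrite !nsnd_npair, !nfst_npair in H.
Qed.

Ltac dec_seq := repeat first
  [ progress dec | assumption | apply Dec_has | apply Comp_entry | progress comp
  | apply Comp_snth | apply Comp_slen ].

Lemma Comp_envlook {I} {O : I -> natset} {m C J} :
  Comp O m C -> Comp O m J -> Comp O m (fun i e => envlook (C i e) (J i e)).
Proof. intros. unfold envlook. comp; auto. Qed.

Lemma Dec_just {I} {O : I -> natset} (V0 V1 : I -> nat -> natset) :
  Dec O 2 (fun i e => V0 i (e 0) (e 1)) -> Dec O 2 (fun i e => V1 i (e 0) (e 1)) ->
  Dec O 6 (fun i e => just (V0 i (e 5)) (V1 i (e 5)) (e 0) (e 1) (e 2) (e 3) (e 4)).
Proof.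
  intros H0 H1. unfold just, args, arg, tv.
  assert (D0 : forall m F G, Comp O m F -> Comp O m G -> Dec O m (fun i e => V0 i (F i e) (G i e)))
    by (intros; now apply (Dec_app2 V0)).
  assert (D1 : forall m F G, Comp O m F -> Comp O m G -> Dec O m (fun i e => V1 i (F i e) (G i e)))
    by (intros; now apply (Dec_app2 V1)).
  dec_seq.
  all: first [apply D0|apply D1|apply Comp_envlook]; comp.
Qed.

Lemma Comp_subst {I} {O : I -> natset} n {m} F (s : I -> (nat -> nat) -> nat -> nat) :
  Comp O n F -> (forall j, j < n -> Comp O m (fun i e => s i e j)) ->
  Comp O m (fun i e => F i (s i e)).
Proof.
  intros [p Hp] Hs.
  assert (H : Comp O m (fun i e => ecode n (s i e))).
  { clear Hp. revert s Hs. induction n; intros s Hs.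
    - apply (Comp_const O m 0).
    - simpl. apply Comp_npair; [apply Hs; lia|].
      apply (IHn (fun i e => tl_env (s i e))). intros j Hj. apply Hs. lia. }
  destruct H as [q Hq]. exists (PComp p q). intros i e. eexists. split; [apply Hq|apply Hp].
Qed.

(** The formula is given by its Gödel number only; the set that is used for set
    variable 0 or 1 may depend on a further number computed by S. The program
    looks for a valid table with an entry for the formula. *)
Lemma Dec_truth {I} {O : I -> natset} {m} (V0 V1 : I -> nat -> natset) (th : I -> formula) C S :
  (forall i, bounded (th i)) -> Comp O 0 (fun i _ => godel (th i)) ->
  Dec O 2 (fun i e => V0 i (e 0) (e 1)) -> Dec O 2 (fun i e => V1 i (e 0) (e 1)) ->
  Comp O m C -> Comp O m S ->
  Dec O m (fun i e => sat (sel (V0 i (S i e)) (V1 i (S i e))) (envlook (C i e)) (th i)).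
Proof.
  intros Hb Hg H0 H1 HC HS.
  apply (Dec_app2 (fun i c s => sat (sel (V0 i s) (V1 i s)) (envlook c) (th i))); auto.
  assert (Hv : Dec O 3 (fun i e => valid (V0 i (e 2)) (V1 i (e 2)) (e 0))).
  { refine (Dec_iff _ (fun i e => iff_sym (valid_iff _ _ _)) _).
    apply (Dec_ball (fun i e => slen (e 0)) (fun i e => let x := snth (e 1) (e 0) in
      just (V0 i (e 3)) (V1 i (e 3)) (e 1)
      (nfst x) (nfst (nsnd x)) (nfst (nsnd (nsnd x))) (nsnd (nsnd (nsnd x))))).
    - apply Comp_slen. comp.
    - cbv zeta.
      refine (Comp_subst 6 _ (fun i e => scons (e 1) (let x := snth (e 1) (e 0) in
        scons (nfst x) (scons (nfst (nsnd x)) (scons (nfst (nsnd (nsnd x)))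
        (scons (nsnd (nsnd (nsnd x))) (fun _ => e 3)))))) (Dec_just V0 V1 H0 H1) _).
      intros [|[|[|[|[|j]]]]] _; simpl; comp; apply Comp_snth; comp. }
  pose proof (fun v => @Dec_has I O 3 _ _ (Comp_var O 3 0 ltac:(lia))
    (Comp_entry (Comp_const O 3 1) (Comp_weaken 3 Hg) (Comp_var O 3 1 ltac:(lia)) (Comp_const O 3 v))) as Hh.
  refine (Dec_search _ _ _ (Dec_and Hv (Dec_or (Hh 1) (Hh 0))) (Hh 1) _ _).
  - intros i e. simpl.
    destruct (table_formula (V0 i (e 1)) (V1 i (e 1)) (th i) (e 0) 0 (Hb i) (valid_empty _ _))
      as (w & Hw & _ & v & Hx).
    exists w. split; auto.
    destruct (valid_formula _ _ _ Hw _ _ _ (Hb i) Hx) as [[_ ->]|[_ ->]]; auto.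
  - intros i e w [Hw Hx]. simpl in Hw, Hx. simpl.
    pose proof (fun v => valid_formula _ _ _ Hw (th i) (e 0) v (Hb i)) as T. unfold tv in T.
    split.
    + intro Hs. destruct Hx as [Hx|Hx]; auto. apply T in Hx. exfalso. intuition lia.
    + intro Hx'. apply T in Hx'. intuition lia.
Qed.

(** * Weihrauch reducibility is transitive *)

Lemma Dec_of_functional {I} {O Y : I -> natset} p :
  (forall i, functional p (O i) (Y i)) -> Dec O 1 (fun i e => Y i (e 0)).
Proof.
  intro H. exists (PComp p PFst). intros i e. simpl.
  exists (e 0). rewrite nfst_npair. split; auto.
  destruct (H i (e 0)) as [H1 H0].
  chi_case (Y i (e 0)); auto.
Qed.

Lemma left_part {I} (X Y : I -> natset) : Dec (fun i => X i ⊕ Y i) 1 (fun i e => X i (e 0)).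
Proof.
  refine (Dec_iff _ (fun i e => join_even _ (Y i) _) (Dec_oracle (F := fun _ e => 2 * e 0) _)).
  comp.
Qed.

Lemma right_part {I} (X Y : I -> natset) : Dec (fun i => X i ⊕ Y i) 1 (fun i e => Y i (e 0)).
Proof.
  refine (Dec_iff _ (fun i e => join_odd (X i) _ _) (Dec_oracle (F := fun _ e => 2 * e 0 + 1) _)).
  comp.
Qed.

Lemma functional_join_left p : exists q, forall X X' Y,
  functional p X X' -> functional q (X ⊕ Y) (X' ⊕ Y).
Proof.
  set (I := {t : natset * natset * natset | functional p (fst (fst t)) (snd (fst t))}).
  set (X := fun i : I => fst (fst (proj1_sig i))).
  set (X' := fun i : I => snd (fst (proj1_sig i))).
  set (Y := fun i : I => snd (proj1_sig i)).
  destruct (Dec_functional _ _ (left_part X Y)) as [l Hl].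
  destruct (Dec_functional (fun i => X i ⊕ Y i) (fun i => X' i ⊕ Y i)) as [q Hq].
  - apply Dec_join; [|apply right_part|comp].
    apply (Dec_of_functional (psubst l p)). intro i.
    apply (functional_psubst p l _ (X i)); [apply Hl|exact (proj2_sig i)].
  - exists q. intros A A' C H. exact (Hq (exist _ (A, A', C) H)).
Qed.

Lemma functional_join_right p : exists q, forall X Y Z,
  functional p (X ⊕ Y) Z -> functional q (X ⊕ Y) (X ⊕ Z).
Proof.
  set (I := {t : natset * natset * natset | functional p (fst (fst t) ⊕ snd (fst t)) (snd t)}).
  set (X := fun i : I => fst (fst (proj1_sig i))).
  set (Y := fun i : I => snd (fst (proj1_sig i))).
  set (Z := fun i : I => snd (proj1_sig i)).
  destruct (Dec_functional (fun i => X i ⊕ Y i) (fun i => X i ⊕ Z i)) as [q Hq].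
  - apply Dec_join; [apply left_part| |comp].
    apply (Dec_of_functional p). intro i. exact (proj2_sig i).
  - exists q. intros A B C H. exact (Hq (exist _ (A, B, C) H)).
Qed.

Lemma weihrauch_trans P Q R : P ≤W Q -> Q ≤W R -> P ≤W R.
Proof.
  intros (p1 & s1 & H1) (p2 & s2 & H2).
  destruct (functional_join_left p1) as [a Ha].
  destruct (functional_join_right (psubst a s2)) as [b Hb].
  exists (psubst p1 p2), (psubst b s1). intros X HX.
  destruct (H1 X HX) as (X1 & F1 & D1 & O1).
  destruct (H2 X1 D1) as (X2 & F2 & D2 & O2).
  exists X2. split; [now apply functional_psubst with X1|]. split; auto.
  intros Y HY. destruct (O2 Y HY) as (Y1 & G2 & HY1).
  destruct (O1 Y1 HY1) as (Z & G1 & HZ).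
  exists Z. split; auto. apply functional_psubst with (X ⊕ Y1); auto.
  apply Hb. apply functional_psubst with (X1 ⊕ Y); auto.
Qed.

Lemma identity_program : exists p, forall X, functional p X X.
Proof.
  apply (Dec_functional (fun X => X) (fun X => X)). apply (Dec_oracle (F := fun _ e => e 0)). comp.
Qed.

Lemma right_program : exists p, forall X Y, functional p (X ⊕ Y) Y.
Proof.
  destruct (Dec_functional _ _ (right_part (fun t : natset * natset => fst t) (fun t => snd t)))
    as [p Hp].
  exists p. intros X Y. exact (Hp (X, Y)).
Qed.

(** * Fixed points from closed points *)

Lemma sat_positive_mono f : positive 0 f -> forall A X X' e,
  X ⊆ X' -> sat (sel X A) e f -> sat (sel X' A) e f.
Proof.
  intros Hp A X X' e HX. revert e. induction f; simpl in *; intros e; auto.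
  - destruct v; simpl; auto.
  - destruct v; simpl; tauto.
  - intuition.
  - intuition.
  - intros (a & ? & ?). eauto.
  - intros (a & ?). eauto.
Qed.

Lemma Gamma_mono f A X X' : positive 0 f -> X ⊆ X' -> Gamma f A X ⊆ Gamma f A X'.
Proof. intros Hp HX n. now apply sat_positive_mono. Qed.

(** If n were in X but not in Γ(X), then X without n would still be closed, by
    monotonicity of Γ, and it is Δ⁰₀ in X. *)
Lemma minimal_closed_fixed k f A X : positive 0 f ->
  LCP_output k A f X -> fixed_point f A X.
Proof.
  intros Hp [Hc Hmin] n. split; [apply Hc|]. intro Hn. apply NNPP. intro N.
  apply Hmin. exists (fun m => X m /\ ~ m = n).
  assert (S : (fun m => X m /\ ~ m = n) ⊆ X) by (intros m [? _]; auto).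
  split; [|split; [|split; auto]].
  - apply Delta0_DeltaP. pose proof (Delta0_refl k (A ⊕ X)) as H. apply Delta0_join_r in H. deltaP.
  - intros m Hm. apply (Gamma_mono f A _ X Hp S) in Hm.
    split; [now apply Hc|]. intros ->. auto.
  - intro E. destruct (E n) as [_ E']. destruct (E' Hn) as [_ E'']. auto.
Qed.

Lemma minimal_closed_LFP k f A X : positive 0 f ->
  LCP_output k A f X -> LFP_output k A f X.
Proof.
  intros Hp H. split; [now apply minimal_closed_fixed in H|].
  intros (Y & HY & Hf & Hs). destruct H as [_ H]. apply H. exists Y.
  split; auto. split; auto. intros n. apply Hf.
Qed.

Lemma LFP_le_LCP k c : LFP k c ≤W LCP k c.
Proof.
  destruct identity_program as [p Hp], right_program as [q Hq].
  exists p, q. intros X HX. exists X. split; auto. split; auto.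
  intros Y (A & f & Hin & Ho). exists Y. split; auto. exists A, f. split; auto.
  apply minimal_closed_LFP; auto. apply Hin.
Qed.

(** * Functions and their initial segments *)

Lemma graph_npair f n v : graph f (npair n v) <-> f n = v.
Proof.
  split.
  - intros [m H]. apply npair_inj in H as [-> ->]. auto.
  - intros <-. now exists n.
Qed.

Lemma graph_inj f g : graph f = graph g -> f = g.
Proof.
  intro H. apply functional_extensionality. intro n.
  symmetry. apply graph_npair. rewrite <- H. now apply graph_npair.
Qed.

Lemma treeset_inj T T' : treeset T = treeset T' -> T = T'.
Proof.
  intro H. apply functional_extensionality. intro s. apply propositional_extensionality.
  now rewrite <- (treeset_seqcode T), H, treeset_seqcode.
Qed.

Lemma LPP_input_unique Z T f T' f' :
  LPP_input Z T f -> LPP_input Z T' f' -> T = T' /\ f = f'.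
Proof.
  intros (_ & _ & _ & H) (_ & _ & _ & H').
  apply set_eq_eq in H. apply set_eq_eq in H'. rewrite H in H'.
  apply join_inj in H' as [E E']. auto using treeset_inj, graph_inj.
Qed.

Lemma length_initseg f n : length (initseg f n) = n.
Proof. unfold initseg. now rewrite length_map, length_seq. Qed.

Lemma nth_initseg f n i : i < n -> nth i (initseg f n) 0 = f i.
Proof.
  intro H. unfold initseg. rewrite nth_indep with (d' := f 0).
  - rewrite map_nth. now rewrite seq_nth.
  - now rewrite length_map, length_seq.
Qed.

Lemma initseg_ext f g n : (forall i, i < n -> f i = g i) -> initseg f n = initseg g n.
Proof.
  intro H. apply map_ext_in. intros i Hi. apply in_seq in Hi. apply H. lia.
Qed.

Lemma initseg_S f n : initseg f (S n) = initseg f n ++ [f n].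
Proof. unfold initseg. now rewrite seq_S, map_app. Qed.

Definition weave {T : Type} (a b : nat -> T) (j : nat) : T :=
  if Nat.even j then a (Nat.div2 j) else b (Nat.div2 j).

Lemma weave_even {T} (a b : nat -> T) i : weave a b (2 * i) = a i.
Proof. unfold weave. now rewrite Nat.even_even, Nat.div2_double. Qed.

Lemma weave_odd {T} (a b : nat -> T) i : weave a b (2 * i + 1) = b i.
Proof. unfold weave. now rewrite Nat.even_odd, Nat.add_1_r, Nat.div2_succ_double. Qed.

Lemma weave_graph (a b : nat -> nat) x : graph (weave a b) x <->
  exists j, j < S x /\ (exists v, v < S x /\ (x = npair j v /\
    ((exists i, i < S j /\ (j = 2 * i /\ a i = v)) \/
     (exists i, i < S j /\ (j = 2 * i + 1 /\ b i = v))))).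
Proof.
  split.
  - intros [j ->]. pose proof (npair_ge j (weave a b j)).
    exists j. split; [lia|]. eexists. split; [|split; [reflexivity|]]; [lia|].
    destruct (even_or_odd j) as [i [->| ->]]; [left|right]; exists i; (split; [lia|]);
      rewrite ?weave_even, ?weave_odd; auto.
  - intros (j & _ & v & _ & -> & H). apply graph_npair.
    destruct H as [(i & _ & -> & <-)|(i & _ & -> & <-)];
      rewrite ?weave_even, ?weave_odd; auto.
Qed.

(** * The matrix of the formula of an operator *)

Definition matrix c (f : formula) : formula :=
  match c, f with
  | Pi01, All t => t
  | Sigma02, Ex (All t) => t
  | _, _ => f
  end.

(** In the Π⁰₁ case there is no x; keeping a dummy argument lets both classes
    be treated alike. *)
Definition mcode c y x n : nat :=
  match c with
  | Pi01 => npair y (npair n 0)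
  | Sigma02 => npair y (npair x (npair n 0))
  end.

Definition holds c (t : formula) X A y x n : Prop :=
  sat (sel X A) (envlook (mcode c y x n)) t.

Lemma envlook_mcode c y x n : envlook (mcode c y x n) =
  match c with
  | Pi01 => scons y (scons n (fun _ => 0))
  | Sigma02 => scons y (scons x (scons n (fun _ => 0)))
  end.
Proof. destruct c; simpl; now rewrite !envlook_cons, envlook_0. Qed.

Lemma matrix_spec c f : in_class c f -> scoped 1 2 f -> positive 0 f ->
  bounded (matrix c f) /\ positive 0 (matrix c f) /\
  scoped (match c with Pi01 => 2 | Sigma02 => 3 end) 2 (matrix c f) /\
  godel (matrix c f) = match c with Pi01 => nsnd (godel f) | Sigma02 => nsnd (nsnd (godel f)) end.
Proof.
  intros Hc Hs Hp. destruct c; simpl in Hc; inversion Hc as [|k g Hg]; subst; simpl in *.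
  - inversion Hg; subst. rewrite nsnd_npair. auto.
  - inversion Hg as [|k g' Hg']; subst; simpl in *. inversion Hg'; subst.
    rewrite !nsnd_npair. auto.
Qed.

Lemma Gamma_matrix c f A X n : in_class c f ->
  Gamma f A X n <-> exists x, forall y, holds c (matrix c f) X A y x n.
Proof.
  intros Hc. unfold Gamma, holds. setoid_rewrite envlook_mcode.
  destruct c; simpl in Hc; inversion Hc as [|k g Hg]; subst; simpl.
  - split; [intro H; exists 0; exact H|intros [_ H]; exact H].
  - inversion Hg; subst. simpl. reflexivity.
Qed.

(** Compactness: a bounded X-positive formula uses finitely many elements of X.
    This makes the condition on the witnesses of a path a closed one. *)
Lemma sat_limit f A (X : natset) (Xs : nat -> natset) :
  bounded f -> positive 0 f ->
  (forall L L', L <= L' -> Xs L ⊆ Xs L') -> (forall n, X n -> exists L, Xs L n) ->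
  forall e, sat (sel X A) e f -> exists L, sat (sel (Xs L) A) e f.
Proof.
  intros Hb Hp Hm HX.
  induction f; simpl in Hb, Hp; intros e; try easy; simpl; try (intro H; now exists 0).
  - destruct v; simpl; [|intro; now exists 0]. apply HX.
  - destruct v; simpl; [easy|]. intro; now exists 0.
  - intros [H1 H2].
    destruct (IHf1 ltac:(tauto) ltac:(tauto) _ H1) as [L1 G1].
    destruct (IHf2 ltac:(tauto) ltac:(tauto) _ H2) as [L2 G2].
    exists (L1 + L2).
    split; eapply sat_positive_mono; try eassumption; try tauto; apply Hm; lia.
  - intros [H1|H2].
    + destruct (IHf1 ltac:(tauto) ltac:(tauto) _ H1) as [L G]. eauto.
    + destruct (IHf2 ltac:(tauto) ltac:(tauto) _ H2) as [L G]. eauto.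
  - intro H. destruct (collection (tval e t) (fun a L => sat (sel (Xs L) A) (scons a e) f))
      as [N HN]; [auto|].
    exists N. intros a Ha. destruct (HN a Ha) as (L & HL & G).
    eapply sat_positive_mono; [assumption| |exact G]. apply Hm. lia.
  - intros (a & Ha & H). destruct (IHf Hb Hp _ H) as [L G]. eauto.
Qed.

(** * The tree of closed points *)

(** The value at the even position 2i is χ_X(i) + 2χ_A(i). As all paths agree on
    A, the order compares the bits of X; the bits of A are recorded because A
    must be definable from the paths. *)
Definition onbit v : Prop := v = 1 \/ v = 3.

Definition cell_ok (a : Prop) v : Prop := (a /\ (v = 2 \/ v = 3)) \/ (~ a /\ (v = 0 \/ v = 1)).

Definition seq_set (s : list nat) : natset :=
  fun n => 2 * n < length s /\ onbit (nth (2 * n) s 0).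

(** The value at position 2i+1, where i codes the pair (n,x), is 0 if n is in X
    and y+1 if y refutes the matrix. The bit of n comes earlier as n ≤ i. *)
Definition wit_ok c t A (X : natset) i v : Prop :=
  (v = 0 /\ X (nfst i)) \/ (exists y, y < v /\ (v = S y /\ ~ holds c t X A y (nsnd i) (nfst i))).

(** The witnesses are tested against the elements of X seen so far. By
    positivity an early acceptance may be revoked later on, but a rejection is
    final, so this is a tree. *)
Definition ctree c t A (s : list nat) : Prop :=
  forall i, i < length s ->
    (2 * i < length s -> cell_ok (A i) (nth (2 * i) s 0)) /\
    (2 * i + 1 < length s -> wit_ok c t A (seq_set s) i (nth (2 * i + 1) s 0)).

Lemma holds_mono c t A X X' y x n : positive 0 t ->
  X ⊆ X' -> holds c t X A y x n -> holds c t X' A y x n.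
Proof. intros Hp HX. now apply sat_positive_mono. Qed.

Lemma ctree_is_tree c t A : positive 0 t -> is_tree (ctree c t A).
Proof.
  intros Hp s u H i Hi.
  assert (Hs : seq_set s ⊆ seq_set (s ++ u)).
  { intros n [H1 H2]. split; [rewrite length_app; lia|]. now rewrite app_nth1. }
  destruct (H i) as [H1 H2]; [rewrite length_app; lia|]. rewrite length_app in H1, H2. split.
  - intro Hl. rewrite <- (app_nth1 s u) by auto. apply H1. lia.
  - intro Hl. rewrite app_nth1 in H2 by auto. destruct H2 as [[? [_ E]]|(y & ? & ? & N)]; [lia| |].
    + left. split; auto. pose proof (nfst_le i). split; [lia|].
      now rewrite <- (app_nth1 s u) by lia.
    + right. exists y. split; auto. split; auto. intro M. apply N. revert M. now apply holds_mono.
Qed.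

Definition path_set (p : nat -> nat) : natset := fun n => onbit (p (2 * n)).

Lemma ctree_path c t A p : bounded t -> positive 0 t ->
  is_path (ctree c t A) p <->
  forall i, cell_ok (A i) (p (2 * i)) /\ wit_ok c t A (path_set p) i (p (2 * i + 1)).
Proof.
  intros Hb Hp.
  assert (Hmono : forall L L', L <= L' -> seq_set (initseg p L) ⊆ seq_set (initseg p L')).
  { intros L L' HL n [H1 H2]. rewrite length_initseg in H1.
    split; [rewrite length_initseg; lia|].
    rewrite nth_initseg in * by lia. auto. }
  assert (Hsub : forall L, seq_set (initseg p L) ⊆ path_set p).
  { intros L n [H1 H2]. rewrite length_initseg in H1.
    rewrite nth_initseg in H2 by lia. auto. }
  assert (Hlim : forall n, path_set p n -> exists L, seq_set (initseg p L) n).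
  { intros n H. exists (2 * n + 1). split; [rewrite length_initseg; lia|].
    rewrite nth_initseg by lia. auto. }
  split.
  - intros H i. split.
    + destruct (H (2 * i + 2) i) as [H1 _]; [rewrite length_initseg; lia|].
      rewrite length_initseg, nth_initseg in H1 by lia. apply H1. lia.
    + assert (HL : forall L, 2 * i + 1 < L ->
        wit_ok c t A (seq_set (initseg p L)) i (p (2 * i + 1))).
      { intros L HL. destruct (H L i) as [_ H2]; [rewrite length_initseg; lia|].
        rewrite length_initseg, nth_initseg in H2 by lia. auto. }
      destruct (HL (2 * i + 2)) as [[E HX]|(y & Hy & E & _)]; [lia|left|right].
      * split; auto. now apply Hsub in HX.
      * exists y. split; auto. split; auto. intro M.
        destruct (sat_limit t A (path_set p) (fun L => seq_set (initseg p L)) Hb Hp Hmono Hlim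
          _ M) as [L G].
        destruct (HL (L + (2 * i + 2))) as [[E' _]|(y' & _ & E' & N)]; [lia|lia|].
        apply N. replace y' with y by lia.
        revert G. apply holds_mono; auto. apply Hmono. lia.
  - intros H L i Hi. rewrite length_initseg in *. destruct (H i) as [H1 H2]. split; intro Hl.
    + now rewrite nth_initseg.
    + rewrite nth_initseg by auto. destruct H2 as [[E HX]|(y & Hy & E & N)]; [left|right].
      * split; auto. pose proof (nfst_le i). split; [rewrite length_initseg; lia|].
        rewrite nth_initseg by lia. auto.
      * exists y. split; auto. split; auto. intro M. apply N. revert M. now apply holds_mono.
Qed.

(** The path of the closed point ω, an input path that is always available *)
Definition full_path (A : natset) : nat -> nat :=
  weave (fun i => 1 + 2 * chi (A i)) (fun _ => 0).

Lemma full_path_is_path c t A : bounded t -> positive 0 t -> is_path (ctree c t A) (full_path A).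
Proof.
  intros Hb Hp. apply ctree_path; auto. intro i. unfold full_path.
  rewrite weave_even, weave_odd. split.
  - unfold cell_ok. chi_case (A i); auto.
  - left. split; auto. unfold path_set. rewrite weave_even. unfold onbit. chi_case (A (nfst i)); auto.
Qed.

Lemma ctree_program c : exists p, forall A f,
  in_class c f -> scoped 1 2 f -> positive 0 f ->
  functional p (A ⊕ singleton (godel f))
    (treeset (ctree c (matrix c f) A) ⊕ graph (full_path A)).
Proof.
  set (I := {i : natset * formula |
    in_class c (snd i) /\ scoped 1 2 (snd i) /\ positive 0 (snd i)}).
  set (A := fun i : I => fst (proj1_sig i)).
  set (f := fun i : I => snd (proj1_sig i)).
  set (O := fun i : I => A i ⊕ singleton (godel (f i))).
  assert (Hf : forall i : I, in_class c (f i) /\ scoped 1 2 (f i) /\ positive 0 (f i)).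
  { intro i. exact (proj2_sig i). }
  assert (DA : forall m F, Comp O m F -> Dec O m (fun i e => A i (F i e))).
  { intros m F HF. apply (Dec_app1 A); auto. apply left_part. }
  assert (Hg : Comp O 0 (fun i _ => godel (f i))).
  { apply (Comp_mu (fun i e => O i (2 * e 0 + 1))).
    - apply Dec_oracle. comp.
    - intros i e. apply join_odd. reflexivity.
    - intros i e a Ha H. apply join_odd in H. unfold singleton in H. simpl in H. lia. }
  assert (Hg' : Comp O 0 (fun i _ => godel (matrix c (f i)))).
  { refine (Comp_ext _ (fun i e => eq_sym (proj2 (proj2 (proj2 (matrix_spec c (f i)
      (proj1 (Hf i)) (proj1 (proj2 (Hf i))) (proj2 (proj2 (Hf i)))))))) _).
    destruct c; comp; auto. }
  assert (HT : Dec O 1 (fun i e => treeset (ctree c (matrix c (f i)) (A i)) (e 0))).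
  { refine (Dec_iff _ (fun i e => iff_sym (treeset_sdec _ _)) _).
    unfold ctree, wit_ok, cell_ok.
    assert (DS : forall m F G, Comp O m F -> Comp O m G ->
      Dec O m (fun i e => seq_set (sdec (F i e)) (G i e))).
    { intros m F G HF HG. apply (Dec_app2 (fun i s n => seq_set (sdec s) n)); auto.
      unfold seq_set, onbit. dec_seq. }
    dec_seq; try (apply DA; comp); try (apply DS; comp).
    unfold holds.
    apply (Dec_truth (fun i s n => seq_set (sdec s) n) (fun i _ n => A i n)
      (fun i => matrix c (f i))
      (fun i e => mcode c (e 0) (nsnd (e 1)) (nfst (e 1)))
      (fun i e => e 2)); auto.
    - intro i. destruct (Hf i) as (? & ? & ?). now apply matrix_spec.
    - apply DS; comp.
    - apply DA; comp.
    - unfold mcode. destruct c; comp.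
    - comp. }
  assert (HF : Dec O 1 (fun i e => graph (full_path (A i)) (e 0))).
  { refine (Dec_iff _ (fun i e => iff_sym (weave_graph _ _ _)) _).
    dec_seq. apply DA. comp. }
  destruct (Dec_functional O (fun i => treeset (ctree c (matrix c (f i)) (A i)) ⊕ graph (full_path (A i))))
    as [p Hp].
  { apply (Dec_join (fun i => treeset (ctree c (matrix c (f i)) (A i)))
      (fun i => graph (full_path (A i))) (fun _ e => e 0)); auto. comp. }
  exists p. intros A' f' H1 H2 H3. exact (Hp (exist _ (A', f') (conj H1 (conj H2 H3)))).
Qed.

Lemma path_set_program : exists p, forall Z g, functional p (Z ⊕ graph g) (path_set g).
Proof.
  set (O := fun i : natset * (nat -> nat) => fst i ⊕ graph (snd i)).
  destruct (Dec_functional O (fun i => path_set (snd i))) as [p Hp].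
  - refine (Dec_iff (P := fun i e =>
      O i (2 * npair (2 * e 0) 1 + 1) \/ O i (2 * npair (2 * e 0) 3 + 1)) _ _ _).
    + intros i e. unfold O. rewrite !join_odd, !graph_npair. reflexivity.
    + apply Dec_or; apply Dec_oracle; comp.
  - exists p. intros Z g. exact (Hp (Z, g)).
Qed.

Lemma DeltaP_holds k B c t Y A {m F G H} :
  bounded t -> scoped (match c with Pi01 => 2 | Sigma02 => 3 end) 2 t ->
  Delta0 k B Y -> Delta0 k B A -> DeltaF k B m F -> DeltaF k B m G -> DeltaF k B m H ->
  DeltaP k B m (fun e => holds c t Y A (F e) (G e) (H e)).
Proof.
  intros Hb Hs HY HA HF HG HH.
  assert (HV : forall v, v < 2 -> Delta0 k B (sel Y A v)).
  { intros [|[|v]] Hv; simpl; auto. }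
  pose proof (DeltaP_sat_bounded k B 2 (sel Y A) t _ Hb Hs HV) as HD.
  destruct c; unfold holds.
  - apply (DeltaP_app2 (fun y n => sat (sel Y A) (envlook (mcode Pi01 y 0 n)) t) F H); auto.
    refine (DeltaP_iff _ _ HD). intro e. rewrite envlook_mcode. apply (sat_ext 2 t 2); auto.
    intros [|[|i]] Hi; simpl; auto; lia.
  - apply (DeltaP_app3 (fun y x n => sat (sel Y A) (envlook (mcode Sigma02 y x n)) t) F G H); auto.
    refine (DeltaP_iff _ _ HD). intro e. rewrite envlook_mcode. apply (sat_ext 2 t 3); auto.
    intros [|[|[|i]]] Hi; simpl; auto; lia.
Qed.

Lemma cell_bits a v : cell_ok a v -> v = chi (onbit v) + 2 * chi a.
Proof.
  unfold cell_ok, onbit. intro H.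
  chi_case a; chi_case (v = 1 \/ v = 3); intuition lia.
Qed.

(** The witnesses for a closed subset Y. A positive witness of the path g is
    kept, which is correct since refuted instances stay refuted in Y. A fresh
    witness is needed only for n that has left the set; it is the least one,
    which keeps the new path at the level of Y. *)
Definition new_witness c t A (Y : natset) (g : nat -> nat) i : nat :=
  if Nat.eq_dec (g (2 * i + 1)) 0 then
    if excluded_middle_informative (Y (nfst i)) then 0
    else S (least (fun y => ~ holds c t Y A y (nsnd i) (nfst i)))
  else g (2 * i + 1).

Definition new_path c t A Y g : nat -> nat :=
  weave (fun i => chi (Y i) + 2 * chi (A i)) (new_witness c t A Y g).

Lemma new_witness_iff c t A (Y : natset) g i v :
  (~ Y (nfst i) -> exists y, ~ holds c t Y A y (nsnd i) (nfst i)) ->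
  new_witness c t A Y g i = v <->
  (g (2 * i + 1) = v /\ ~ v = 0) \/ (g (2 * i + 1) = 0 /\ Y (nfst i) /\ v = 0) \/
  (g (2 * i + 1) = 0 /\ ~ Y (nfst i) /\ exists y, y < v /\ (v = S y /\
     ~ holds c t Y A y (nsnd i) (nfst i) /\
     forall y', y' < y -> holds c t Y A y' (nsnd i) (nfst i))).
Proof.
  intro HE. unfold new_witness. destruct (Nat.eq_dec (g (2 * i + 1)) 0) as [E|E].
  - destruct (excluded_middle_informative (Y (nfst i))) as [HY|HY].
    + intuition lia.
    + destruct (least_spec _ (HE HY)) as [L1 L2]. set (l := least _) in *. split.
      * intros <-. right. right. split; auto. split; auto. exists l. split; [lia|].
        split; auto. split; auto. intros y' Hy'. apply NNPP. now apply L2.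
      * intros [[? ?]|[(? & ? & ?)|(_ & _ & y & _ & -> & N & H)]]; try lia; try tauto.
        f_equal. destruct (Nat.lt_trichotomy l y) as [Q|[Q|Q]]; auto.
        -- now apply H in Q.
        -- now apply L2 in Q.
  - intuition lia.
Qed.

Lemma closed_point_witness c f A Y n x : in_class c f -> closed_point f A Y -> ~ Y n ->
  exists y, ~ holds c (matrix c f) Y A y x n.
Proof.
  intros Hc HY Hn. apply NNPP. intro N. apply Hn, HY.
  apply (Gamma_matrix c); auto. exists x. intro y. apply NNPP. eauto.
Qed.

Lemma path_set_closed c f A g : in_class c f -> scoped 1 2 f -> positive 0 f ->
  is_path (ctree c (matrix c f) A) g -> closed_point f A (path_set g).
Proof.
  intros Hc Hs Hpos Hg n Hn. destruct (matrix_spec c f Hc Hs Hpos) as (Mb & Mp & _).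
  apply (Gamma_matrix c) in Hn as [x Hx]; auto.
  rewrite ctree_path in Hg by auto.
  destruct (Hg (npair n x)) as [_ [[_ H]|(y & _ & _ & N)]].
  - now rewrite nfst_npair in H.
  - rewrite nfst_npair, nsnd_npair in N. exfalso. auto.
Qed.

Lemma new_path_is_path c f A Y g : in_class c f -> scoped 1 2 f -> positive 0 f ->
  is_path (ctree c (matrix c f) A) g -> closed_point f A Y -> Y ⊆ path_set g ->
  is_path (ctree c (matrix c f) A) (new_path c (matrix c f) A Y g).
Proof.
  intros Hc Hs Hp Hg HY HS. destruct (matrix_spec c f Hc Hs Hp) as (Mb & Mp & _).
  rewrite ctree_path in * by auto. intro i. unfold new_path at 1 3.
  rewrite weave_even, weave_odd. split.
  - unfold cell_ok. chi_case (Y i); chi_case (A i); simpl; intuition lia.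
  - assert (E : path_set (new_path c (matrix c f) A Y g) = Y).
    { apply set_eq_eq. intro n. unfold path_set, new_path. rewrite weave_even.
      unfold onbit. chi_case (Y n); chi_case (A n); simpl; intuition lia. }
    rewrite E. clear E.
    pose proof (closed_point_witness c f A Y (nfst i) (nsnd i) Hc HY) as HE.
    destruct (proj1 (new_witness_iff c (matrix c f) A Y g i _ HE) eq_refl)
      as [[E N]|[(_ & H & E)|(_ & _ & y & Hy & E & N & _)]].
    + destruct (Hg i) as [_ [[E' _]|(y & Hy & E' & M)]]; [congruence|].
      rewrite <- E. right. exists y. split; auto. split; auto. intro M'. apply M.
      revert M'. now apply holds_mono.
    + left. auto.
    + right. exists y. auto.
Qed.

(** At the least n in the old set but not in Y the new bit is smaller. Before
    that position nothing changes: the pairs treated there concern numbers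
    below n, for which the two sets agree. *)
Lemma new_path_lex c t A Y g : bounded t -> positive 0 t ->
  is_path (ctree c t A) g -> Y ⊊ path_set g -> lex_lt (new_path c t A Y g) g.
Proof.
  intros Mb Mp Hg [HS HN]. rewrite ctree_path in Hg by auto.
  destruct (least_exists (fun n => path_set g n /\ ~ Y n)) as (n & [Hn1 Hn2] & Hmin).
  { apply NNPP. intro N. apply HN. intro n. split; [apply HS|].
    intro H. apply NNPP. intro. apply N. eauto. }
  assert (Eq : forall i, i < n -> (Y i <-> path_set g i)).
  { intros i Hi. split; [apply HS|]. intro H. apply NNPP. intro H'. apply (Hmin i Hi). auto. }
  exists (2 * n). split.
  - apply initseg_ext. intros j Hj. unfold new_path.
    destruct (even_or_odd j) as [i [->| ->]]; rewrite ?weave_even, ?weave_odd.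
    + rewrite (cell_bits _ _ (proj1 (Hg i))). f_equal.
      assert (Hi : i < n) by lia. apply Eq in Hi. unfold path_set in Hi.
      chi_case (Y i); [rewrite chi_true|rewrite chi_false]; tauto.
    + unfold new_witness. destruct (Nat.eq_dec (g (2 * i + 1)) 0) as [E|]; auto.
      destruct (excluded_middle_informative (Y (nfst i))) as [|N]; auto.
      destruct (Hg i) as [_ [[_ H]|(y & _ & E' & _)]]; [|lia].
      apply Eq in H; [easy|]. pose proof (nfst_le i). lia.
  - unfold new_path. rewrite weave_even, (cell_bits _ _ (proj1 (Hg n))).
    rewrite (chi_false _ Hn2), (chi_true (onbit (g (2 * n))) Hn1). lia.
Qed.

Lemma new_path_definable k c f A Y g :
  in_class c f -> scoped 1 2 f -> positive 0 f -> closed_point f A Y ->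
  is_path (ctree c (matrix c f) A) g ->
  Delta0 k (A ⊕ path_set g) Y -> forall T,
  Delta0 k (T ⊕ graph (full_path A) ⊕ graph g) (graph (new_path c (matrix c f) A Y g)).
Proof.
  intros Hc Hs Hp HY Hg HD T. destruct (matrix_spec c f Hc Hs Hp) as (Mb & Mp & Ms & _).
  set (B := T ⊕ graph (full_path A) ⊕ graph g).
  assert (DG : forall k, Delta0 k B (graph g)).
  { intro. apply Delta0_join_r with (X := T ⊕ graph (full_path A)), Delta0_refl. }
  assert (DA : forall k, Delta0 k B A).
  { intro l.
    assert (Delta0 l B (graph (full_path A))).
    { eapply Delta0_join_r, Delta0_join_l, Delta0_refl. }
    apply Delta0_DeltaP. refine (DeltaP_iff (P := fun e => graph (full_path A) (npair (2 * e 0) 3)) _ _ _).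
    - intro e. rewrite graph_npair. unfold full_path. rewrite weave_even.
      chi_case (A (e 0)); simpl; intuition discriminate.
    - deltaP. }
  assert (DX : Delta0 0 B (path_set g)).
  { apply Delta0_DeltaP. refine (DeltaP_iff (P := fun e =>
      graph g (npair (2 * e 0) 1) \/ graph g (npair (2 * e 0) 3)) _ _ _).
    - intro e. rewrite !graph_npair. reflexivity.
    - deltaP. }
  assert (DY : Delta0 k B Y).
  { apply Delta0_trans0 with (A ⊕ path_set g); auto. now apply Delta0_join. }
  apply Delta0_DeltaP.
  refine (DeltaP_iff _ (fun e => iff_sym (weave_graph _ _ _)) _).
  refine (DeltaP_iff _ (P := fun e => exists j, j < S (e 0) /\ (exists v, v < S (e 0) /\
    (e 0 = npair j v /\
     ((exists i, i < S j /\ (j = 2 * i /\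
         ((Y i /\ A i /\ v = 3) \/ (Y i /\ ~ A i /\ v = 1) \/
          (~ Y i /\ A i /\ v = 2) \/ (~ Y i /\ ~ A i /\ v = 0)))) \/
      (exists i, i < S j /\ (j = 2 * i + 1 /\
        ((graph g (npair (2 * i + 1) v) /\ ~ v = 0) \/
         (graph g (npair (2 * i + 1) 0) /\ Y (nfst i) /\ v = 0) \/
         (graph g (npair (2 * i + 1) 0) /\ ~ Y (nfst i) /\ exists y, y < v /\ (v = S y /\
         ~ holds c (matrix c f) Y A y (nsnd i) (nfst i) /\
         forall y', y' < y -> holds c (matrix c f) Y A y' (nsnd i) (nfst i)))))))))) _ _).
  - intro e.
    assert (E1 : forall i v, ((Y i /\ A i /\ v = 3) \/ (Y i /\ ~ A i /\ v = 1) \/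
          (~ Y i /\ A i /\ v = 2) \/ (~ Y i /\ ~ A i /\ v = 0)) <-> chi (Y i) + 2 * chi (A i) = v).
    { intros i v. chi_case (Y i); chi_case (A i); simpl; intuition lia. }
    pose proof (fun i v => new_witness_iff c (matrix c f) A Y g i v
      (closed_point_witness c f A Y (nfst i) (nsnd i) Hc HY)) as E2.
    setoid_rewrite E1. setoid_rewrite E2. setoid_rewrite graph_npair. reflexivity.
  - deltaP.
    + refine (DeltaP_holds k B c _ Y A Mb Ms DY (DA k) _ _ _); deltaF.
    + refine (DeltaP_holds k B c _ Y A Mb Ms DY (DA k) _ _ _); deltaF.
Qed.

Theorem LCP_le_LPP k c : LCP k c ≤W LPP k.
Proof.
  destruct (ctree_program c) as [p Hp], path_set_program as [q Hq].
  exists p, q. intros Z (A & f & Hin). destruct Hin as (Hc & Hs & Hpos & HZ).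
  apply set_eq_eq in HZ. subst Z.
  destruct (matrix_spec c f Hc Hs Hpos) as (Mb & Mp & _).
  set (T := ctree c (matrix c f) A).
  assert (Hin : LPP_input (treeset T ⊕ graph (full_path A)) T (full_path A)).
  { split; [now apply ctree_is_tree|]. split; [eexists; now apply full_path_is_path|].
    split; [now apply full_path_is_path|]. intro; tauto. }
  exists (treeset T ⊕ graph (full_path A)). split; [now apply Hp|]. split; [simpl; eauto|].
  intros W (T' & f' & g & Hin' & (Hg & Hmin) & HW).
  apply set_eq_eq in HW. subst W.
  destruct (LPP_input_unique _ _ _ _ _ Hin Hin') as [<- <-].
  exists (path_set g). split; [apply Hq|].
  exists A, f. split; [repeat split; auto; tauto|]. split; [now apply path_set_closed with c|].
  intros (Y & HD & HY & HYX). apply Hmin. exists (new_path c (matrix c f) A Y g).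
  split; [|split].
  - apply new_path_is_path; auto. apply HYX.
  - now apply new_path_definable.
  - now apply new_path_lex.
Qed.

(** * Gödel numbers determine formulas *)

Lemma tgodel_inj : forall t t', tgodel t = tgodel t' -> t = t'.
Proof.
  induction t; intros [] H; simpl in H; apply npair_inj in H as [E H]; try discriminate E;
    try apply npair_inj in H as [? ?]; f_equal; auto.
Qed.

Lemma godel_inj : forall f f', godel f = godel f' -> f = f'.
Proof.
  induction f; intros [] H; simpl in H; apply npair_inj in H as [E H]; try discriminate E;
    try apply npair_inj in H as [? ?]; f_equal; auto using tgodel_inj.
Qed.

Lemma op_input_unique c A f A' f' :
  op_input c (A ⊕ singleton (godel f)) A' f' -> A' = A /\ f' = f.
Proof.
  intros (_ & _ & _ & H). apply set_eq_eq in H. apply join_inj in H as [-> H].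
  split; auto. apply godel_inj.
  change (singleton (godel f) (godel f')). rewrite H. reflexivity.
Qed.

(** * The operator whose closed points are complements of pruned subtrees *)

Definition child (s s' : list nat) : Prop :=
  length s' = S (length s) /\ forall i, i < length s -> nth i s' 0 = nth i s 0.

Definition left_of (s' s : list nat) : Prop :=
  exists i, i < length s /\ (length s' = S i /\
    (forall j, j < i -> nth j s' 0 = nth j s 0) /\ nth i s' 0 < nth i s 0).

Lemma list_snoc (s : list nat) i : length s = S i -> exists s0 m, s = s0 ++ [m] /\ length s0 = i.
Proof.
  intro H. destruct (exists_last (l := s)) as (s0 & m & ->); [now intros ->|].
  rewrite length_app in H. simpl in H. exists s0, m. split; [auto|lia].
Qed.

Lemma nth_eq (s s' : list nat) : length s = length s' ->
  (forall i, i < length s -> nth i s 0 = nth i s' 0) -> s = s'.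
Proof. apply nth_ext. Qed.

Lemma child_snoc s s' : child s s' <-> exists m, s' = s ++ [m].
Proof.
  split.
  - intros [H1 H2]. apply list_snoc in H1 as (s0 & m & -> & H). exists m. f_equal.
    apply nth_eq; auto. intros i Hi. rewrite <- H2 by lia. now rewrite app_nth1.
  - intros [m ->]. split.
    + rewrite length_app. simpl. lia.
    + intros i Hi. now rewrite app_nth1.
Qed.

Lemma left_of_split s' s : left_of s' s <->
  exists u m m' r, s' = u ++ [m'] /\ s = u ++ m :: r /\ m' < m.
Proof.
  split.
  - intros (i & Hi & Hl & Heq & Hlt). apply list_snoc in Hl as (u & m' & -> & Hu).
    rewrite (nth_middle u [] m' 0) in Hlt || rewrite app_nth2 in Hlt by lia.
    replace (i - length u) with 0 in Hlt by lia. simpl in Hlt.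
    exists u, (nth i s 0), m', (skipn (S i) s). repeat split; auto.
    rewrite <- (firstn_skipn i s) at 1. f_equal.
    + apply nth_eq; [rewrite length_firstn; lia|].
      intros j Hj. rewrite length_firstn in Hj. rewrite nth_firstn.
      destruct (Nat.ltb_spec j i) as [Hji|]; [|lia]. rewrite <- Heq by lia. now rewrite app_nth1 by lia.
    + clear -Hi. revert i Hi. induction s; intros [|i] Hi; simpl in *; try lia; auto.
      apply IHs. lia.
  - intros (u & m & m' & r & -> & -> & H). exists (length u).
    rewrite !length_app. simpl. repeat split; try lia.
    + intros j Hj. now rewrite !app_nth1.
    + now rewrite !nth_middle.
Qed.

Lemma left_of_code s' s : left_of s' s -> seqcode s' <= seqcode s.
Proof.
  intro H. apply left_of_split in H as (u & m & m' & r & -> & -> & H).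
  induction u; simpl; apply le_n_S; apply npair_mono; lia.
Qed.

Lemma length_le_code s : length s <= seqcode s.
Proof.
  induction s as [|a s IH]; simpl; [lia|]. pose proof (npair_ge a (seqcode s)). lia.
Qed.

(** A node with padding is a pair of the code of a sequence and a number. *)
Definition childset (T : list nat -> Prop) : natset := fun x =>
  T (sdec (nfst (nsnd x))) /\ child (sdec (nfst (nfst x))) (sdec (nfst (nsnd x))).

Definition nthset : natset := fun x =>
  nfst (nsnd x) < slen (nfst x) /\ snth (nfst x) (nfst (nsnd x)) = nsnd (nsnd x).

Definition leftset : natset := fun x => left_of (sdec (nsnd x)) (sdec (nfst x)).

(** Besides the tree and the path, the parameter of the operator contains tables
    for operations on codes of sequences. Relative to them these operations are
    Δ⁰₀, with no coding of sequences inside arithmetic. *)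
Definition parm T f : natset :=
  childset T ⊕ ((treeset T ⊕ graph f) ⊕ (nthset ⊕ leftset)).

(** The bounded part of ∀u (∀b≤u, u = (n,b) → u in [childset T] → b in X), where u
    is variable 1 below b. The equation u = (n,b) is multiplied by 2, so that no
    division occurs; [childset T] is the even part of the parameter. *)
Definition opbody (n : term) : formula :=
  BAll (Add (Var 0) One) (Or
    (Neq (Add (Var 1) (Var 1))
      (Add (Mul (Add n (Var 0)) (Add (Add n (Var 0)) One)) (Add (Var 0) (Var 0))))
    (Or (Nmem (Add (Var 1) (Var 1)) 1) (Mem (Var 0) 0))).

Definition op c : formula :=
  match c with
  | Pi01 => All (opbody (Var 2))
  | Sigma02 => Ex (All (opbody (Var 3)))
  end.

Lemma op_ok c : in_class c (op c) /\ scoped 1 2 (op c) /\ positive 0 (op c).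
Proof.
  destruct c; simpl; repeat split; auto with arith; repeat constructor.
Qed.

Lemma opbody_spec C Z X n e t :
  (forall a b, tval (scons b (scons a e)) t = n) ->
  (forall a, sat (sel X (C ⊕ Z)) (scons a e) (opbody t)) <->
  forall b, C (npair n b) -> X b.
Proof.
  intros Ht. unfold opbody. cbn [sat tval]. setoid_rewrite Ht. simpl. split.
  - intros H b Hb. destruct (H (npair n b) b) as [N|[N|]]; auto.
    + pose proof (npair_ge n b). lia.
    + exfalso. apply N. pose proof (npair_spec n b). lia.
    + exfalso. apply N. replace (npair n b + npair n b) with (2 * npair n b) by lia.
      now apply join_even.
  - intros H u b _.
    destruct (Nat.eq_dec u (npair n b)) as [->|N].
    + destruct (classic (C (npair n b))) as [HC|HC]; auto. right. left.
      replace (npair n b + npair n b) with (2 * npair n b) by lia. now rewrite join_even.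
    + left. pose proof (npair_spec n b). lia.
Qed.

Lemma Gamma_op c T f X n :
  Gamma (op c) (parm T f) X n <-> forall b, childset T (npair n b) -> X b.
Proof.
  destruct c; unfold Gamma, op, parm.
  - rewrite <- (opbody_spec (childset T) ((treeset T ⊕ graph f) ⊕ (nthset ⊕ leftset)) X n
      (scons n (fun _ => 0)) (Var 2)) by reflexivity. reflexivity.
  - transitivity (exists x : nat, forall b, childset T (npair n b) -> X b).
    + pose proof (fun x => opbody_spec (childset T)
        ((treeset T ⊕ graph f) ⊕ (nthset ⊕ leftset)) X n
        (scons x (scons n (fun _ => 0))) (Var 3) (fun _ _ => eq_refl)) as H.
      split; intros [x Hx]; exists x; [exact (proj1 (H x) Hx)|exact (proj2 (H x) Hx)].
    + split; [intros [_ H]; exact H|intro H; exists 0; exact H].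
Qed.

Lemma childset_spec T s w b : childset T (npair (npair (seqcode s) w) b) <->
  exists m w', b = npair (seqcode (s ++ [m])) w' /\ T (s ++ [m]).
Proof.
  unfold childset. rewrite nfst_npair, nsnd_npair, nfst_npair, sdec_seqcode, child_snoc.
  split.
  - intros [HT [m E]]. exists m, (nsnd b). rewrite <- E, seqcode_sdec, npair_eta. auto.
  - intros (m & w' & -> & HT). rewrite nfst_npair, sdec_seqcode. eauto.
Qed.

Lemma nthset_spec c i a : nthset (npair c (npair i a)) <-> i < slen c /\ snth c i = a.
Proof. unfold nthset. now rewrite !nsnd_npair, !nfst_npair. Qed.

Lemma leftset_spec c c' : leftset (npair c c') <-> left_of (sdec c') (sdec c).
Proof. unfold leftset. now rewrite nsnd_npair, nfst_npair. Qed.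

Lemma Dec_left_of {I} {O : I -> natset} {m F G} : Comp O m F -> Comp O m G ->
  Dec O m (fun i e => left_of (sdec (F i e)) (sdec (G i e))).
Proof.
  apply (Dec_app2 (fun _ x y => left_of (sdec x) (sdec y))).
  unfold left_of. dec_seq.
Qed.

Lemma parm_program c : exists p, forall T f,
  functional p (treeset T ⊕ graph f) (parm T f ⊕ singleton (godel (op c))).
Proof.
  set (T := fun i : (list nat -> Prop) * (nat -> nat) => fst i).
  set (f := fun i : (list nat -> Prop) * (nat -> nat) => snd i).
  set (O := fun i => treeset (T i) ⊕ graph (f i)).
  destruct (Dec_functional O (fun i => parm (T i) (f i) ⊕ singleton (godel (op c)))) as [p Hp].
  - assert (V : Comp O 1 (fun _ e => e 0)) by comp.
    apply (Dec_join (fun i => parm (T i) (f i)) (fun _ => singleton (godel (op c))) (fun _ e => e 0)); auto.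
    + apply (Dec_join (fun i => childset (T i)) (fun i => _) (fun _ e => e 0)); auto.
      * assert (DT : forall m F, Comp O m F -> Dec O m (fun i e => T i (sdec (F i e)))).
        { intros m F HF. refine (Dec_iff _ (fun i e => treeset_sdec _ _) _).
          apply (Dec_app1 (fun i => treeset (T i))); auto. apply left_part. }
        unfold childset, child. dec_seq. apply DT. comp.
      * apply (Dec_join (fun i => treeset (T i) ⊕ graph (f i)) (fun i => nthset ⊕ leftset)
          (fun _ e => e 0)); auto.
        -- apply (Dec_oracle V).
        -- apply (Dec_join (fun i => nthset) (fun i => leftset) (fun _ e => e 0)); auto.
           ++ unfold nthset. dec_seq.
           ++ unfold leftset. apply Dec_left_of; comp.
    + unfold singleton. dec.
  - exists p. intros T' f'. exact (Hp (T', f')).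
Qed.

(** * The pruned tree of a fixed point and its leftmost path *)

Definition live (X : natset) (s : list nat) : Prop := ~ X (npair (seqcode s) 0).

Definition child_fixed T (X : natset) : Prop :=
  forall n, X n <-> forall b, childset T (npair n b) -> X b.

Lemma live_step T X s w : child_fixed T X ->
  ~ X (npair (seqcode s) w) <->
  exists m w', T (s ++ [m]) /\ ~ X (npair (seqcode (s ++ [m])) w').
Proof.
  intro H. rewrite (H (npair (seqcode s) w)). split.
  - intro N. apply NNPP. intro N'. apply N. intros b Hb.
    apply childset_spec in Hb as (m & w' & -> & HT). apply NNPP. intro. apply N'. eauto.
  - intros (m & w' & HT & HX) N. apply HX, N, childset_spec. eauto.
Qed.

(** In a fixed point the padding is irrelevant, since the children of a node do
    not depend on it. *)
Lemma live_pad T X s w : child_fixed T X -> ~ X (npair (seqcode s) w) <-> live X s.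
Proof.
  intro H. unfold live. now rewrite (live_step T X s w), (live_step T X s 0).
Qed.

Lemma live_child T X s : child_fixed T X -> live X s <-> exists m, T (s ++ [m]) /\ live X (s ++ [m]).
Proof.
  intro H. unfold live at 1. rewrite (live_step T X s 0) by auto. split.
  - intros (m & w & HT & HX). exists m. split; auto.
    exact (proj1 (live_pad T X _ _ H) HX).
  - intros (m & HT & HX). exists m, 0. auto.
Qed.

Lemma live_tree T X s : is_tree T -> child_fixed T X -> live X s -> T s.
Proof. intros HT H Hs. apply (live_child T) in Hs as (m & Hm & _); auto. now apply HT in Hm. Qed.

Lemma live_parent T X s m : is_tree T -> child_fixed T X -> live X (s ++ [m]) -> live X s.
Proof.
  intros HT H Hs. apply (live_child T); auto. exists m. split; auto. now apply (live_tree T X).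
Qed.

Fixpoint leftmost (X : natset) n : list nat :=
  match n with
  | 0 => []
  | S n => leftmost X n ++ [least (fun m => live X (leftmost X n ++ [m]))]
  end.

Definition leftpath X n : nat := least (fun m => live X (leftmost X n ++ [m])).

Lemma initseg_leftpath X n : initseg (leftpath X) n = leftmost X n.
Proof. induction n; [reflexivity|]. now rewrite initseg_S, IHn. Qed.

Lemma leftmost_live T X n : child_fixed T X -> live X [] -> live X (leftmost X n).
Proof.
  intros H H0. induction n; simpl; auto.
  apply (least_spec (fun m => live X (leftmost X n ++ [m]))).
  apply (live_child T) in IHn as (m & _ & ?); eauto.
Qed.

Lemma leftmost_least X n m : live X (leftmost X n ++ [m]) -> leftpath X n <= m.
Proof.
  intros Hm. destruct (least_spec (fun m => live X (leftmost X n ++ [m])) (ex_intro _ m Hm)) as [_ L].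
  apply Nat.le_ngt. intro N. exact (L m N Hm).
Qed.

(** Initial segments of the leftmost path are recognized by looking only at the
    finitely many nodes to the left, whose codes are not larger
    ([left_of_code]). *)
Definition live_left X s : Prop := live X s /\ forall s', left_of s' s -> ~ live X s'.

Lemma live_left_iff T X s : is_tree T -> child_fixed T X -> live X [] ->
  live_left X s <-> s = leftmost X (length s).
Proof.
  intros HT H H0. split.
  - induction s as [|m s IH] using rev_ind; [reflexivity|]. intros [Hs HN].
    rewrite length_app, Nat.add_1_r. simpl.
    assert (E : s = leftmost X (length s)).
    { apply IH. split; [now apply (live_parent T X s m)|].
      intros s' Hs'. apply HN. apply left_of_split in Hs' as (u & a & b & r & -> & -> & ?).
      apply left_of_split. exists u, a, b, (r ++ [m]). rewrite <- app_assoc. auto. }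
    rewrite <- E. f_equal. f_equal.
    assert (L : leftpath X (length s) <= m).
    { apply leftmost_least. now rewrite <- E. }
    assert (G : live X (s ++ [leftpath X (length s)])).
    { pose proof (leftmost_live T X (S (length s)) H H0) as G. simpl in G.
      unfold leftpath. now rewrite <- E in *. }
    unfold leftpath in L, G. rewrite <- E in L, G.
    apply Nat.le_antisymm; auto. apply Nat.le_ngt. intro N.
    apply (HN _ (proj2 (left_of_split _ _) (ex_intro _ s (ex_intro _ m (ex_intro _ _
      (ex_intro _ [] (conj eq_refl (conj eq_refl N)))))))). exact G.
  - intros ->. split; [now apply leftmost_live with T|].
    intros s' Hs' HL. apply left_of_split in Hs' as (u & a & b & r & -> & E & Hlt).
    rewrite <- initseg_leftpath in E.
    assert (Hlen : length u < length s).
    { apply (f_equal (@length nat)) in E. rewrite length_initseg, length_app in E. simpl in E. lia. }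
    assert (Eu : u = leftmost X (length u)).
    { rewrite <- initseg_leftpath. apply nth_eq; [now rewrite length_initseg|].
      intros i Hi. rewrite nth_initseg by auto.
      rewrite <- (nth_initseg (leftpath X) (length s)) by lia. rewrite E. now rewrite app_nth1. }
    assert (Ea : a = leftpath X (length u)).
    { rewrite <- (nth_initseg (leftpath X) (length s)) by lia. rewrite E. now rewrite nth_middle. }
    rewrite Eu in HL. apply leftmost_least in HL. lia.
Qed.

Lemma leftpath_is_path T X : is_tree T -> child_fixed T X -> live X [] -> is_path T (leftpath X).
Proof.
  intros HT H H0 n. rewrite initseg_leftpath. apply (live_tree T X); auto. now apply (leftmost_live T).
Qed.

Definition left_code (X : natset) c : Prop :=
  ~ X (npair c 0) /\ forall c', c' < S c -> leftset (npair c c') -> X (npair c' 0).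

Lemma left_code_iff X c : left_code X c <-> live_left X (sdec c).
Proof.
  unfold left_code, live_left, live. rewrite seqcode_sdec. split; intros [H1 H2]; split; auto.
  - intros s' Hs' N. apply N, H2.
    + apply left_of_code in Hs'. rewrite seqcode_sdec in Hs'. lia.
    + apply leftset_spec. now rewrite sdec_seqcode.
  - intros c' _ Hc'. rewrite leftset_spec in Hc'. apply H2 in Hc'. rewrite seqcode_sdec in Hc'.
    now apply NNPP.
Qed.

(** The value g(n) is read off any recognized segment of length above n: one
    exists, which gives the Σ form, and all agree, which gives the Π form. *)
Lemma leftpath_definable T f X : is_tree T -> child_fixed T X -> live X [] ->
  Delta0 1 (parm T f ⊕ X) (graph (leftpath X)).
Proof.
  intros HT H H0. set (C := parm T f ⊕ X).
  assert (DX : Delta0 0 C X) by (eapply Delta0_join_r, Delta0_refl).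
  assert (DP : Delta0 0 C (parm T f)) by (eapply Delta0_join_l, Delta0_refl).
  assert (DN : Delta0 0 C nthset).
  { eapply Delta0_join_l, Delta0_join_r, Delta0_join_r. exact DP. }
  assert (DL : Delta0 0 C leftset).
  { eapply Delta0_join_r, Delta0_join_r, Delta0_join_r. exact DP. }
  assert (Hcode : forall c, left_code X c <-> sdec c = initseg (leftpath X) (slen c)).
  { intro c. rewrite left_code_iff, (live_left_iff T) by auto. now rewrite initseg_leftpath. }
  assert (Hself : forall n, left_code X (seqcode (initseg (leftpath X) n))).
  { intro n. apply Hcode. now rewrite sdec_seqcode, length_initseg. }
  apply Delta0_DeltaP. split.
  - refine (SigmaP_iff _ _ (fun e => exists c, left_code X c /\ nthset (npair c (e 0))) _ _ _).
    + intro e. rewrite <- (npair_eta (e 0)). split.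
      * intros (c & Hc & Hn). rewrite nthset_spec in Hn; destruct Hn as [Hl Hn]. apply Hcode in Hc.
        rewrite Hc, nth_initseg in Hn by auto. now apply graph_npair.
      * intro Hg. apply graph_npair in Hg.
        exists (seqcode (initseg (leftpath X) (S (nfst (e 0))))).
        split; auto. apply nthset_spec. rewrite sdec_seqcode, length_initseg, nth_initseg; auto.
    + apply (SigmaP_ex 0 1 (fun e => left_code X (e 0) /\ nthset (npair (e 0) (e 1)))).
      refine (proj2 (_ : DeltaP 0 C 2 _)). unfold left_code. deltaP.
  - refine (PiP_iff _ _ (fun e => forall c, left_code X c -> forall v, v < S c ->
      nthset (npair c (npair (nfst (e 0)) v)) -> v = nsnd (e 0)) _ _ _).
    + intro e. transitivity (leftpath X (nfst (e 0)) = nsnd (e 0));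
        [|now rewrite <- graph_npair, npair_eta]. split.
      * intro G. apply (G (seqcode (initseg (leftpath X) (S (nfst (e 0)))))); auto.
        -- pose proof (seqcode_In (leftpath X (nfst (e 0))) (initseg (leftpath X) (S (nfst (e 0))))) as L.
           rewrite initseg_S in L at 1. specialize (L (in_elt _ _ _)). lia.
        -- apply nthset_spec. rewrite sdec_seqcode, length_initseg, nth_initseg; auto.
      * intros E c Hc v _ Hn. rewrite nthset_spec in Hn; destruct Hn as [Hl Hn]. apply Hcode in Hc.
        rewrite Hc, nth_initseg in Hn by auto. congruence.
    + apply (PiP_all 0 1 (fun e => left_code X (e 0) -> forall v, v < S (e 0) ->
      nthset (npair (e 0) (npair (nfst (e 1)) v)) -> v = nsnd (e 1))).
      refine (proj1 (_ : DeltaP 0 C 2 _)). unfold left_code. deltaP.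
Qed.

Lemma leftpath_program : exists p, forall Z T X, is_tree T -> child_fixed T X -> live X [] ->
  functional p (Z ⊕ X) (graph (leftpath X)).
Proof.
  set (I := {i : natset * (list nat -> Prop) * natset |
    is_tree (snd (fst i)) /\ child_fixed (snd (fst i)) (snd i) /\ live (snd i) []}).
  set (Z := fun i : I => fst (fst (proj1_sig i))).
  set (X := fun i : I => snd (proj1_sig i)).
  assert (Hcode : forall (i : I) c, left_code (X i) c <-> sdec c = initseg (leftpath (X i)) (slen c)).
  { intros [[[A T] X'] (HT & H & H0)] c. unfold X. simpl in *.
    rewrite left_code_iff, (live_left_iff T) by auto. now rewrite initseg_leftpath. }
  destruct (Dec_functional (fun i => Z i ⊕ X i) (fun i => graph (leftpath (X i)))) as [p Hp].
  - apply (Dec_search (fun i e => left_code (X i) (e 0) /\ slen (e 0) = S (nfst (e 1)))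
      (fun i e => snth (e 0) (nfst (e 1)) = nsnd (e 1))).
    + assert (DX : forall m F, Comp (fun i => Z i ⊕ X i) m F ->
        Dec (fun i => Z i ⊕ X i) m (fun i e => X i (F i e))).
      { intros m F HF. apply (Dec_app1 X); auto. apply right_part. }
      unfold left_code, leftset. dec_seq; first [apply DX; comp|apply Dec_left_of; comp].
    + dec_seq.
    + intros i e. exists (seqcode (initseg (leftpath (X i)) (S (nfst (e 0))))). cbn [scons].
      now rewrite Hcode, sdec_seqcode, length_initseg.
    + intros i e c [Hc Hl]. cbn [scons] in Hc, Hl |- *. apply Hcode in Hc.
      rewrite Hc, nth_initseg by lia. now rewrite <- graph_npair, npair_eta.
  - exists p. intros A T X' HT H H0. exact (Hp (exist _ (A, T, X') (conj HT (conj H H0)))).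
Qed.

Definition captures j T f X : Prop :=
  forall h, is_path T h -> Delta0 (S j) (parm T f ⊕ X) (graph h) ->
  forall n, live X (initseg h n).

(** A path h to the left of g leaves it at a node that is not in the pruned
    tree, although all nodes of definable paths are. The level of h is raised
    to a positive one because g is Δ⁰₁ in X. *)
Lemma leftpath_LPP_output k j T f X : k <= S j ->
  is_tree T -> child_fixed T X -> live X [] -> captures j T f X ->
  LPP_output k T f (leftpath X).
Proof.
  intros Hk HT H H0 Hcap. split; [now apply leftpath_is_path|].
  intros (h & Hh & HD & n & En & Hlt).
  assert (HB : Delta0 1 (parm T f ⊕ X) (treeset T ⊕ graph f ⊕ graph (leftpath X))).
  { apply Delta0_join; [|now apply leftpath_definable].
    eapply Delta0_join_l, Delta0_join_r, Delta0_join_l, Delta0_refl. }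
  apply (Delta0_le _ _ _ _ Hk) in HD. apply (Delta0_trans j _ _ _ HB) in HD.
  pose proof (Hcap h Hh HD (S n)) as HL. rewrite initseg_S, En, initseg_leftpath in HL.
  apply leftmost_least in HL. lia.
Qed.

(** What is common to all levels. The input path f is among the captured paths,
    and this makes the root live. *)
Lemma LPP_reduction k j c (Q : problem) : k <= S j ->
  (forall Z A f, op_input c Z A f -> dom Q Z) ->
  (forall T f X, is_tree T -> is_path T f ->
    out Q (parm T f ⊕ singleton (godel (op c))) X -> child_fixed T X /\ captures j T f X) ->
  LPP k ≤W Q.
Proof.
  intros Hk Hdom Hout.
  destruct (parm_program c) as [p Hp], leftpath_program as [q Hq].
  exists p, q. intros Z (T & f & HT & Hill & Hf & HZ). pose proof HZ as HZ'.
  apply set_eq_eq in HZ'. subst Z.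
  exists (parm T f ⊕ singleton (godel (op c))). split; [apply Hp|]. split.
  - apply (Hdom _ (parm T f) (op c)). destruct (op_ok c) as (? & ? & ?).
    repeat split; auto; tauto.
  - intros X HX. destruct (Hout T f X HT Hf HX) as [H Hcap].
    assert (H0 : live X []).
    { apply (Hcap f Hf) with (n := 0).
      eapply Delta0_join_r, Delta0_join_l, Delta0_join_r, Delta0_join_l, Delta0_refl. }
    exists (graph (leftpath X)). split; [now apply (Hq _ T)|].
    exists T, f, (leftpath X). split; [repeat split; auto; tauto|].
    split; [now apply leftpath_LPP_output with j|intro; tauto].
Qed.

Definition on_path (h : nat -> nat) c : Prop := sdec c = initseg h (slen c).

Lemma on_path_iff h c : on_path h c <->
  forall i, i < S c -> forall a, a < S c ->
    nthset (npair c (npair i a)) -> graph h (npair i a).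
Proof.
  unfold on_path. setoid_rewrite nthset_spec. setoid_rewrite graph_npair. split.
  - intros E i _ a _ [Hi Ha]. rewrite E, nth_initseg in Ha; auto.
  - intro H. apply nth_eq; [now rewrite length_initseg|]. intros i Hi.
    rewrite nth_initseg by auto. symmetry.
    pose proof (length_le_code (sdec c)). pose proof (seqcode_In _ _ (nth_In _ 0 Hi)).
    rewrite seqcode_sdec in *. apply H; auto; lia.
Qed.

Lemma on_path_child T h n b : childset T (npair n b) ->
  on_path h (nfst b) -> on_path h (nfst n).
Proof.
  rewrite <- (npair_eta n), <- (seqcode_sdec (nfst n)). intro Hb.
  apply childset_spec in Hb as (m & w' & -> & HT). unfold on_path.
  rewrite !nfst_npair, !sdec_seqcode, length_app, Nat.add_1_r, initseg_S. intro E.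
  now apply app_inj_tail in E as [E _].
Qed.

Lemma on_path_next T h n : is_path T h -> on_path h (nfst n) ->
  forall w, childset T (npair n (npair (seqcode (initseg h (S (slen (nfst n))))) w)).
Proof.
  intros Hh Hn w. rewrite <- (npair_eta n), <- (seqcode_sdec (nfst n)).
  apply childset_spec. rewrite nfst_npair, sdec_seqcode. unfold on_path in Hn.
  exists (h (slen (nfst n))), w. rewrite Hn at 2 4. rewrite <- initseg_S. split; auto.
Qed.

(** If a node of h were in X, removing all nodes of h, with any padding, would
    give a smaller fixed point: a node has a child on h only if it is on h. *)
Lemma LFP_captures j c T f X : LFP_output (S j) (parm T f) (op c) X ->
  child_fixed T X /\ captures j T f X.
Proof.
  intros [Hfix Hmin]. assert (H : child_fixed T X).
  { intro n. rewrite <- (Gamma_op c T f). symmetry. apply Hfix. }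
  split; auto. intros h Hh HD n HX.
  apply Hmin. exists (fun x => X x /\ ~ on_path h (nfst x)).
  set (C := parm T f ⊕ X) in *.
  assert (DX : Delta0 (S j) C X) by (eapply Delta0_join_r, Delta0_refl).
  assert (DN : Delta0 (S j) C nthset).
  { eapply Delta0_join_l, Delta0_join_r, Delta0_join_r, Delta0_join_l, Delta0_refl. }
  split; [|split; [|split]].
  - apply Delta0_DeltaP. refine (DeltaP_iff _ (fun e => and_iff_compat_l _ (not_iff_compat
      (iff_sym (on_path_iff _ _)))) _). deltaP.
  - intro x. rewrite Gamma_op. split.
    + intro G. split; [apply H; intros b Hb; now apply G|].
      intro Hx. pose proof (on_path_next T h x Hh Hx 0) as Hc.
      apply G in Hc as [_ N]. apply N. unfold on_path.
      now rewrite nfst_npair, sdec_seqcode, length_initseg.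
    + intros [Hx Np] b Hb. split; [now apply (proj1 (H x) Hx)|].
      intro Hp. apply Np. now apply (on_path_child T h x b).
  - intros x [Hx _]. auto.
  - intro E. apply (E _) in HX as [_ N]. apply N. unfold on_path.
    now rewrite nfst_npair, sdec_seqcode, length_initseg.
Qed.

Theorem LPP_le_LFP j c : LPP (S j) ≤W LFP (S j) c.
Proof.
  apply (LPP_reduction (S j) j c); auto.
  - intros Z A f Hin. exists A, f. auto.
  - intros T f X HT Hf (A & g & Hin & Ho).
    apply op_input_unique in Hin as [-> ->]. now apply LFP_captures in Ho.
Qed.

(** The same argument with only those nodes removed whose padding bounds the
    search for the Σ⁰₁ witnesses of the values of h. Each removed node has a
    removed child, which may need a larger padding; this is all that a closed
    point requires. *)
Lemma LCP0_captures c T f X : LCP_output 0 (parm T f) (op c) X ->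
  child_fixed T X /\ captures 0 T f X.
Proof.
  intro Ho. destruct (op_ok c) as (_ & _ & Hpos).
  pose proof (minimal_closed_fixed _ _ _ _ Hpos Ho) as Hfix.
  destruct Ho as [_ Hmin]. assert (H : child_fixed T X).
  { intro n. rewrite <- (Gamma_op c T f). symmetry. apply Hfix. }
  split; auto. intros h Hh HD n HX.
  set (C := parm T f ⊕ X) in *.
  apply Delta0_DeltaP in HD as [HS _]. apply SigmaP_ex_inv in HS as (Q & HQ & EQ).
  assert (DQ : DeltaP 0 C 2 Q).
  { destruct HQ as (g & Hg & ? & Eg). inversion Hg. now apply (DeltaP_bounded g). }
  set (R := fun z x => Q (scons z (fun _ => x))).
  assert (ER : forall x, graph h x <-> exists z, R z x).
  { intro x. exact (EQ (fun _ => x)). }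
  assert (DR : DeltaP 0 C 2 (fun e => R (e 0) (e 1))).
  { destruct DQ as [(g & Hg & Hs & Eg) _]. inversion Hg; subst.
    apply (DeltaP_bounded g); auto. intro e. unfold R. rewrite <- Eg.
    apply (sat_ext 1 g 2); auto. intros [|[|i]] Hi; simpl; auto; lia. }
  set (H' := fun x => forall i, i < S (nfst x) -> forall a, a < S (nfst x) ->
    nthset (npair (nfst x) (npair i a)) -> exists z, z < nsnd x /\ R z (npair i a)).
  assert (Hon : forall x, H' x -> on_path h (nfst x)).
  { intros x Hx. apply on_path_iff. intros i Hi a Ha Hn.
    destruct (Hx i Hi a Ha Hn) as (z & _ & Hz). apply ER. eauto. }
  assert (Hex : forall m, exists w, H' (npair (seqcode (initseg h m)) w)).
  { intro m.
    destruct (collection m (fun i z => R z (npair i (h i)))) as [w Hw].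
    - intros i _. apply ER. now apply graph_npair.
    - exists w. intros i _ a _ Hn. rewrite nfst_npair, nthset_spec, sdec_seqcode, length_initseg in Hn.
      destruct Hn as [Hi Ha]. rewrite nth_initseg in Ha by auto. subst a.
      rewrite nsnd_npair. auto. }
  apply Hmin. exists (fun x => X x /\ ~ H' x).
  assert (DX : Delta0 0 C X) by (eapply Delta0_join_r, Delta0_refl).
  assert (DN : Delta0 0 C nthset).
  { eapply Delta0_join_l, Delta0_join_r, Delta0_join_r, Delta0_join_l, Delta0_refl. }
  split; [|split; [|split]].
  - apply Delta0_DeltaP. unfold H'. deltaP. apply (DeltaP_app2 R); auto; deltaF.
  - intros x G. rewrite Gamma_op in G.
    split; [apply H; intros b Hb; now apply G|].
    intro Hx. apply Hon in Hx.
    destruct (Hex (S (slen (nfst x)))) as [w Hw].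
    pose proof (on_path_next T h x Hh Hx w) as Hc. apply G in Hc as [_ N]. auto.
  - intros x [Hx _]. auto.
  - intro E. destruct (Hex n) as [w Hw].
    assert (Xw : X (npair (seqcode (initseg h n)) w)).
    { apply NNPP. intro N. exact (proj1 (live_pad T X _ w H) N HX). }
    apply (E _) in Xw as [_ N]. auto.
Qed.

Theorem LPP_le_LCP k c : LPP k ≤W LCP k c.
Proof.
  destruct k as [|j].
  - apply (LPP_reduction 0 0 c); auto.
    + intros Z A f Hin. exists A, f. auto.
    + intros T f X HT Hf (A & g & Hin & Ho).
      apply op_input_unique in Hin as [-> ->]. now apply LCP0_captures in Ho.
  - apply weihrauch_trans with (LFP (S j) c); [apply LPP_le_LFP|apply LFP_le_LCP].
Qed.

Theorem corollary7p14 (k : nat) :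
  (LCP k Pi01 ≡W LCP k Sigma02 /\ LCP k Sigma02 ≡W LPP k) /\
  (k = 2 -> LPP k ≡W LFP k Pi01) /\
  (3 <= k -> LPP k ≡W LFP k Pi01 /\ LFP k Pi01 ≡W LFP k Sigma02).
Proof.
  assert (LC : forall c c', LCP k c ≤W LCP k c').
  { intros c c'. apply weihrauch_trans with (LPP k); [apply LCP_le_LPP|apply LPP_le_LCP]. }
  assert (FL : forall c, LFP k c ≤W LPP k).
  { intro c. apply weihrauch_trans with (LCP k c); [apply LFP_le_LCP|apply LCP_le_LPP]. }
  assert (LF : 1 <= k -> forall c, LPP k ≤W LFP k c).
  { intros Hk c. destruct k as [|j]; [lia|]. apply LPP_le_LFP. }
  assert (FF : 1 <= k -> forall c c', LFP k c ≤W LFP k c').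
  { intros Hk c c'. apply weihrauch_trans with (LPP k); auto. }
  split; [|split].
  - split; split; auto; [apply LCP_le_LPP|apply LPP_le_LCP].
  - intro Hk. split; auto. apply LF. lia.
  - intro Hk. split; split; auto; [apply LF|apply FF|apply FF]; lia.
Qed.
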